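(* Let $f$ satisfy (f1) and suppose $f_0\in(0,+\infty)$ and $f_\infty=+\infty$. Then for every $\lambda\in(0,\lambda_1/f_0)$, problem (MO) has two solutions $u^+$ and $u^-$ such that $u^+$ is positive and strictly concave in $(0,1)$ and $u^-$ is negative and strictly convex in $(0,1)$.
   Context: Let $N\ge 1$ be an integer and $f:\mathbb{R}\to\mathbb{R}$ continuous. For $\lambda\ge 0$, problem (MO) is: find $u\in C^2[0,1]$ with $\left((u'(r))^N\right)'=\lambda^N N r^{N-1} f(-u(r))$ for $0<r<1$ and $u'(0)=u(1)=0$. Condition (f1): $f\in C(\mathbb{R},\mathbb{R})$ and $f(s)s^N>0$ for all $s\neq0$. The quantities $f_0,f_\infty\in[0,+\infty]$ are defined by $f_0^N=\lim_{s\to0} f(s)/s^N$ and $f_\infty^N=\lim_{|s|\to+\infty} f(s)/s^N$ (limits assumed to exist in $[0,+\infty]$). $\lambda_1>0$ denotes the first eigenvalue of $\left((-v')^N\right)'=\lambda^N N r^{N-1}v^N$ in $(0,1)$, $v'(0)=v(1)=0$, i.e. the unique $\lambda>0$ for which this problem has a solution $v\in C^2[0,1]$ positive in $(0,1)$. *)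

(* Defs.v *)
From Stdlib Require Import Reals.
Open Scope R_scope.

Definition deriv_on01 (g g' : R -> R) : Prop :=
  forall r, 0 <= r <= 1 ->
  forall eps, 0 < eps -> exists delta, 0 < delta /\
    forall h, h <> 0 -> Rabs h < delta -> 0 <= r + h <= 1 ->
      Rabs ((g (r + h) - g r) / h - g' r) < eps.

Definition cont_on01 (g : R -> R) : Prop :=
  forall r, 0 <= r <= 1 ->
  forall eps, 0 < eps -> exists delta, 0 < delta /\
    forall s, 0 <= s <= 1 -> Rabs (s - r) < delta -> Rabs (g s - g r) < eps.

Definition solves_MO (N : nat) (f : R -> R) (lam : R) (u : R -> R) : Prop :=
  exists u1 u2 : R -> R,
    deriv_on01 u u1 /\ deriv_on01 u1 u2 /\ cont_on01 u2 /\
    (forall r, 0 < r < 1 ->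
       derivable_pt_lim (fun s => (u1 s) ^ N) r
         (lam ^ N * INR N * r ^ (N - 1) * f (- u r))) /\
    u1 0 = 0 /\ u 1 = 0.

Definition has_pos_eigenfunction (N : nat) (lam : R) : Prop :=
  exists v v1 v2 : R -> R,
    deriv_on01 v v1 /\ deriv_on01 v1 v2 /\ cont_on01 v2 /\
    (forall r, 0 < r < 1 ->
       derivable_pt_lim (fun s => (- v1 s) ^ N) r
         (lam ^ N * INR N * r ^ (N - 1) * (v r) ^ N)) /\
    v1 0 = 0 /\ v 1 = 0 /\
    (forall r, 0 < r < 1 -> 0 < v r).

Definition is_first_eigenvalue (N : nat) (lam1 : R) : Prop :=
  0 < lam1 /\ has_pos_eigenfunction N lam1 /\
  (forall lam, 0 < lam -> has_pos_eigenfunction N lam -> lam = lam1).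

Definition cond_f1 (N : nat) (f : R -> R) : Prop :=
  continuity f /\ (forall s, s <> 0 -> f s * s ^ N > 0).

Definition f_zero_limit (N : nat) (f : R -> R) (f0 : R) : Prop :=
  forall eps, 0 < eps -> exists delta, 0 < delta /\
    forall s, s <> 0 -> Rabs s < delta -> Rabs (f s / s ^ N - f0 ^ N) < eps.

Definition f_infty_plus_infty (N : nat) (f : R -> R) : Prop :=
  forall M, exists K, forall s, K < Rabs s -> M < f s / s ^ N.

Definition strictly_concave_01 (u : R -> R) : Prop :=
  forall x y t, 0 < x < 1 -> 0 < y < 1 -> x <> y -> 0 < t < 1 ->
    u (t * x + (1 - t) * y) > t * u x + (1 - t) * u y.

Definition strictly_convex_01 (u : R -> R) : Prop :=
  forall x y t, 0 < x < 1 -> 0 < y < 1 -> x <> y -> 0 < t < 1 ->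
    u (t * x + (1 - t) * y) < t * u x + (1 - t) * u y.

(* Main.v *)
Require Import Defs.
From Stdlib Require Import Reals Lra Lia ZArith ClassicalEpsilon Classical Cantor.
Open Scope R_scope.

(** Up to the symmetry [u -> -u], a solution of constant sign is a positive [w] with
    [((-w')^N)' = lam^N N r^(N-1) g(w)], [w'(0) = w(1) = 0], where [g] is [f] or [(-1)^N f(-s)].
    It is found by shooting in [a = w(0)].  Since [g] is only continuous, initial value problems
    need not be uniquely solvable, so the intermediate value theorem is applied to Euler
    polygons, whose endpoint depends continuously on [a], and the polygons vanishing at [1] are
    passed to the limit by an Ascoli argument.  The same compactness lets the sign of the endpoint
    be decided for exact solutions: for small [a] comparison with the eigenfunction gives
    [w(1) > 0] because [lam f0 < lam1], and for large [a] superlinearity gives [w(1) < 0]. *)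

(** The unknowns are [w] and [J] with [(-w')^N = lam^N J]. Every shot starts at [J = 0], where the
    N-th root giving the slope is not Lipschitz once [N >= 2], so regularity of [g] alone would not
    restore a Lipschitz system. Both equations are read in Stieltjes form, [dw = - root(J) d(lam r)]
    and [dJ = G(w) d(r^N)]: they then have one shape, the weight [N r^(N-1)] is integrated exactly,
    and one discretisation and one limit argument serve for both. The nonlinearity is replaced by
    [G(s) = g(clamp 0 A s)], which is bounded and nonnegative whatever sign [w] takes. This bounds
    [J] and makes all approximations equi-Lipschitz up to the mesh size. The truncation disappears
    at the end, since the solution decreases from [w(0) <= A] to [0]. The shooting interval [[d, A]]
    has [d > 0], which excludes the zero solution. The gap between [lam f0] and [lam1] leaves room
    for a [mu] strictly in between, and [mu / lam1 < 1] is the contraction factor of the comparison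
    with the eigenfunction. *)

Lemma continuity_pt_eps (f : R -> R) (x : R) :
  continuity_pt f x <->
  forall eps, 0 < eps -> exists delta, 0 < delta /\
    forall y, Rabs (y - x) < delta -> Rabs (f y - f x) < eps.
Proof.
  split.
  - intros H eps He. destruct (H eps He) as [d [Hd H']]. exists d; split; [exact Hd|].
    intros y Hy. destruct (Req_dec x y) as [<-|Hne].
    + now rewrite Rminus_diag, Rabs_R0.
    + apply H'. split; [split; [exact I|exact Hne]|exact Hy].
  - intros H eps He. destruct (H eps He) as [d [Hd H']]. exists d; split; [exact Hd|].
    intros y [_ Hy]. now apply H'.
Qed.

(** * Calculus on the closed unit interval *)

Definition clamp (a b x : R) : R := Rmax a (Rmin b x).

Lemma clamp_bounds (a b x : R) : a <= b -> a <= clamp a b x <= b.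
Proof.
  intros H; unfold clamp; split; [apply Rmax_l|].
  apply Rmax_lub; [exact H|apply Rmin_l].
Qed.

Lemma clamp_id (a b x : R) : a <= x <= b -> clamp a b x = x.
Proof.
  intros [H1 H2]; unfold clamp. rewrite Rmin_right by lra. now apply Rmax_right.
Qed.

Lemma clamp_lipschitz (a b x y : R) : Rabs (clamp a b x - clamp a b y) <= Rabs (x - y).
Proof.
  unfold clamp, Rmax, Rmin.
  repeat destruct (Rle_dec _ _); unfold Rabs; repeat destruct (Rcase_abs _); lra.
Qed.

Lemma continuity_clamp (a b : R) : continuity (clamp a b).
Proof.
  intros x; apply continuity_pt_eps; intros eps He; exists eps; split; [exact He|].
  intros y Hy; eapply Rle_lt_trans; [apply clamp_lipschitz|exact Hy].
Qed.

(** Precomposition with the clamp extends [F] to the whole line by its endpoint values. Closure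
    properties, the mean value theorem and the intermediate value theorem on the line thereby become
    available on [[0,1]]. *)
Lemma cont_on01_clamp (F : R -> R) : cont_on01 F -> continuity (fun x => F (clamp 0 1 x)).
Proof.
  intros H x; apply continuity_pt_eps; intros eps He.
  destruct (H (clamp 0 1 x) (clamp_bounds 0 1 x ltac:(lra)) eps He) as [d [Hd H']].
  exists d; split; [exact Hd|]; intros y Hy. apply H'; [apply clamp_bounds; lra|].
  eapply Rle_lt_trans; [apply clamp_lipschitz|exact Hy].
Qed.

Lemma continuity_cont_on01 (f : R -> R) : continuity f -> cont_on01 f.
Proof.
  intros H r _ eps He. destruct (proj1 (continuity_pt_eps f r) (H r) eps He) as [d [Hd H']].
  exists d; split; auto.
Qed.

Lemma cont_on01_ext (F G : R -> R) :
  (forall r, 0 <= r <= 1 -> F r = G r) -> cont_on01 F -> cont_on01 G.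
Proof.
  intros E H r Hr eps He. destruct (H r Hr eps He) as [d [Hd H']]. exists d; split; [exact Hd|].
  intros s Hs Hd'. rewrite <- !E by assumption. now apply H'.
Qed.

Lemma cont_on01_comp (f F : R -> R) :
  continuity f -> cont_on01 F -> cont_on01 (fun r => f (F r)).
Proof.
  intros Hf HF. apply cont_on01_ext with (fun r => f (F (clamp 0 1 r))).
  - intros r Hr; now rewrite clamp_id.
  - apply continuity_cont_on01. intros x.
    apply (continuity_pt_comp (fun x => F (clamp 0 1 x)) f); [apply cont_on01_clamp; exact HF|apply Hf].
Qed.

Lemma cont_on01_plus (F G : R -> R) :
  cont_on01 F -> cont_on01 G -> cont_on01 (fun r => F r + G r).
Proof.
  intros HF HG. apply cont_on01_ext with (fun r => F (clamp 0 1 r) + G (clamp 0 1 r)).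
  - intros r Hr; now rewrite clamp_id.
  - apply continuity_cont_on01.
    apply (continuity_plus _ _ (cont_on01_clamp _ HF) (cont_on01_clamp _ HG)).
Qed.

Lemma cont_on01_mult (F G : R -> R) :
  cont_on01 F -> cont_on01 G -> cont_on01 (fun r => F r * G r).
Proof.
  intros HF HG. apply cont_on01_ext with (fun r => F (clamp 0 1 r) * G (clamp 0 1 r)).
  - intros r Hr; now rewrite clamp_id.
  - apply continuity_cont_on01.
    apply (continuity_mult _ _ (cont_on01_clamp _ HF) (cont_on01_clamp _ HG)).
Qed.

Lemma cont_on01_inv (F : R -> R) :
  cont_on01 F -> (forall r, 0 <= r <= 1 -> F r <> 0) -> cont_on01 (fun r => / F r).
Proof.
  intros HF H0. apply cont_on01_ext with (fun r => / F (clamp 0 1 r)).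
  - intros r Hr; now rewrite clamp_id.
  - apply continuity_cont_on01.
    apply (continuity_inv _ (cont_on01_clamp _ HF)). intros x; apply H0, clamp_bounds; lra.
Qed.

Lemma cont_on01_const (c : R) : cont_on01 (fun _ => c).
Proof. apply continuity_cont_on01, continuity_const; now intros x y. Qed.

Lemma continuity_pow_nat (n : nat) : continuity (fun x => x ^ n).
Proof. apply derivable_continuous, derivable_pow. Qed.

Lemma deriv_on01_cont (F F' : R -> R) : deriv_on01 F F' -> cont_on01 F.
Proof.
  intros H r Hr eps He.
  destruct (H r Hr 1 ltac:(lra)) as [d [Hd H']].
  set (K := Rabs (F' r) + 1). assert (HK : 0 < K) by (unfold K; pose proof (Rabs_pos (F' r)); lra).
  exists (Rmin d (eps / K)). split.
  - apply Rmin_pos; [exact Hd|]. now apply Rdiv_lt_0_compat.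
  - intros s Hs Hsr. destruct (Req_dec s r) as [->|Hne].
    + now rewrite Rminus_diag, Rabs_R0.
    + specialize (H' (s - r) ltac:(lra)). replace (r + (s - r)) with s in H' by ring.
      specialize (H' (Rlt_le_trans _ _ _ Hsr (Rmin_l _ _)) Hs).
      set (q := (F s - F r) / (s - r)) in *.
      assert (Hq : Rabs q < K).
      { unfold K. replace q with ((q - F' r) + F' r) by ring.
        eapply Rle_lt_trans; [apply Rabs_triang|]. lra. }
      replace (F s - F r) with (q * (s - r)) by (unfold q; field; lra).
      rewrite Rabs_mult.
      assert (Hs2 := Rlt_le_trans _ _ _ Hsr (Rmin_r _ _)).
      assert (0 < Rabs (s - r)) by (apply Rabs_pos_lt; lra).
      apply Rlt_le_trans with (K * Rabs (s - r)); [apply Rmult_lt_compat_r; lra|].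
      apply Rlt_le in Hs2. apply Rmult_le_compat_l with (r := K) in Hs2; [|lra].
      replace (K * (eps / K)) with eps in Hs2 by (field; lra). exact Hs2.
Qed.

Lemma deriv_on01_interior (F F' : R -> R) (r : R) :
  deriv_on01 F F' -> 0 < r < 1 -> derivable_pt_lim F r (F' r).
Proof.
  intros H Hr eps He. destruct (H r ltac:(lra) eps He) as [d [Hd H']].
  assert (Hm : 0 < Rmin d (Rmin r (1 - r))) by (repeat apply Rmin_pos; lra).
  exists (mkposreal _ Hm). simpl. intros h Hh Hlt.
  assert (H1 := Rlt_le_trans _ _ _ Hlt (Rmin_l _ _)).
  assert (H2 := Rlt_le_trans _ _ _ Hlt (Rmin_r _ _)).
  assert (H3 := Rlt_le_trans _ _ _ H2 (Rmin_l _ _)).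
  assert (H4 := Rlt_le_trans _ _ _ H2 (Rmin_r _ _)).
  apply H'; auto. apply Rabs_def2 in H3. apply Rabs_def2 in H4. lra.
Qed.

Lemma derivable_pt_lim_local (f g : R -> R) (x l eta : R) :
  0 < eta -> (forall y, Rabs (y - x) < eta -> f y = g y) ->
  derivable_pt_lim f x l -> derivable_pt_lim g x l.
Proof.
  intros Heta E H eps He. destruct (H eps He) as [[d Hd] H']. simpl in H'.
  assert (Hm : 0 < Rmin d eta) by now apply Rmin_pos.
  exists (mkposreal _ Hm); simpl. intros h Hh Hlt.
  assert (H1 := Rlt_le_trans _ _ _ Hlt (Rmin_l _ _)).
  assert (H2 := Rlt_le_trans _ _ _ Hlt (Rmin_r _ _)).
  rewrite <- (E (x + h)), <- (E x).
  - now apply H'.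
  - rewrite Rminus_diag, Rabs_R0; exact Heta.
  - now replace (x + h - x) with h by ring.
Qed.

Lemma derivable_pt_lim_local01 (f g : R -> R) (x l : R) :
  0 < x < 1 -> (forall y, 0 < y < 1 -> f y = g y) ->
  derivable_pt_lim f x l -> derivable_pt_lim g x l.
Proof.
  intros Hx E. apply derivable_pt_lim_local with (Rmin x (1 - x)).
  - apply Rmin_pos; lra.
  - intros y Hy. apply E.
    assert (H3 := Rlt_le_trans _ _ _ Hy (Rmin_l _ _)).
    assert (H4 := Rlt_le_trans _ _ _ Hy (Rmin_r _ _)).
    apply Rabs_def2 in H3. apply Rabs_def2 in H4. lra.
Qed.

Lemma mvt01 (F F' : R -> R) (a b : R) :
  cont_on01 F -> (forall r, 0 < r < 1 -> derivable_pt_lim F r (F' r)) ->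
  0 <= a -> a < b -> b <= 1 ->
  exists c, a < c < b /\ F b - F a = F' c * (b - a).
Proof.
  intros HF HF' Ha Hab Hb.
  set (Fc := fun x => F (clamp 0 1 x)).
  assert (D : forall c, a < c < b -> derivable_pt_lim Fc c (F' c)).
  { intros c Hc. apply derivable_pt_lim_local01 with F; [lra| |apply HF'; lra].
    intros y Hy; unfold Fc; rewrite clamp_id; [reflexivity|lra]. }
  assert (pr1 : forall c, a < c < b -> derivable_pt Fc c)
    by (intros c Hc; exists (F' c); now apply D).
  assert (pr2 : forall c, a < c < b -> derivable_pt id c)
    by (intros c _; apply derivable_pt_id).
  destruct (MVT Fc id a b pr1 pr2 Hab) as [c [P E]].
  - intros c _; now apply cont_on01_clamp.
  - intros c _; apply derivable_continuous_pt, derivable_pt_id.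
  - exists c; split; [exact P|].
    rewrite (derive_pt_eq_0 Fc c (F' c)) in E by now apply D.
    rewrite (derive_pt_eq_0 id c 1) in E by apply derivable_pt_lim_id.
    unfold Fc, id in E. rewrite !clamp_id in E by lra. lra.
Qed.

(** By the mean value theorem a difference quotient at an endpoint is a value of [F'] at a nearby
    interior point. Hence differential equations need only be tracked on the open interval, and
    continuity of the derivative supplies the endpoints. *)
Lemma deriv_on01_of_interior (F F' : R -> R) :
  cont_on01 F -> (forall r, 0 < r < 1 -> derivable_pt_lim F r (F' r)) ->
  cont_on01 F' -> deriv_on01 F F'.
Proof.
  intros HF HD HF' r Hr eps He.
  destruct (HF' r Hr eps He) as [d [Hd H']]. exists d; split; [exact Hd|].
  intros h Hh Hlt Hrh. apply Rabs_def2 in Hlt.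
  destruct (Rtotal_order h 0) as [Hneg|[->|Hpos]]; [|lra|].
  - destruct (mvt01 F F' (r + h) r HF HD) as [c [Hc E]]; try lra.
    replace ((F (r + h) - F r) / h) with (F' c).
    + apply H'; [lra|]. apply Rabs_def1; lra.
    + replace (F (r + h) - F r) with (- (F r - F (r + h))) by ring. rewrite E. field; lra.
  - destruct (mvt01 F F' r (r + h) HF HD) as [c [Hc E]]; try lra.
    replace ((F (r + h) - F r) / h) with (F' c).
    + apply H'; [lra|]. apply Rabs_def1; lra.
    + rewrite E. field; lra.
Qed.

Lemma mono_of_deriv01 (F F' : R -> R) (a b : R) :
  cont_on01 F -> (forall r, 0 < r < 1 -> derivable_pt_lim F r (F' r)) ->
  0 <= a -> a <= b -> b <= 1 -> (forall r, a < r < b -> 0 <= F' r) -> F a <= F b.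
Proof.
  intros HF HD Ha Hab Hb Hpos. destruct (Req_dec a b) as [->|Hne]; [lra|].
  destruct (mvt01 F F' a b HF HD) as [c [Hc E]]; try lra.
  specialize (Hpos c Hc). assert (0 <= F' c * (b - a)) by (apply Rmult_le_pos; lra). lra.
Qed.

(** * The N-th root *)

Definition root (N : nat) (x : R) : R :=
  if Rle_dec x 0 then 0 else Rpower x (/ INR N).

Lemma root_nonneg (N : nat) (x : R) : 0 <= root N x.
Proof. unfold root. destruct (Rle_dec x 0); [lra|]. apply Rlt_le, exp_pos. Qed.

Lemma root_0 (N : nat) : root N 0 = 0.
Proof. unfold root. destruct (Rle_dec 0 0); lra. Qed.

Lemma root_pos (N : nat) (x : R) : 0 < x -> 0 < root N x.
Proof. unfold root. destruct (Rle_dec x 0); [lra|]. intros _; apply exp_pos. Qed.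

Lemma root_pow (N : nat) (x : R) : (1 <= N)%nat -> 0 <= x -> root N x ^ N = x.
Proof.
  intros HN Hx. unfold root. destruct (Rle_dec x 0).
  - rewrite pow_i by lia. lra.
  - rewrite <- Rpower_pow by apply exp_pos. rewrite Rpower_mult, Rinv_l.
    + apply Rpower_1; lra.
    + apply not_0_INR; lia.
Qed.

Lemma pow_le_inv (N : nat) (x y : R) : (1 <= N)%nat -> 0 <= y -> x ^ N <= y ^ N -> x <= y.
Proof.
  intros HN Hy H. destruct (Rle_or_lt x y) as [|Hlt]; [assumption|].
  exfalso. assert (y ^ N < x ^ N); [|lra].
  destruct N as [|N]; [lia|]. clear HN H. induction N as [|N IH]; [simpl; lra|].
  change (y * y ^ S N < x * x ^ S N).
  apply Rmult_le_0_lt_compat; try lra. apply pow_le; lra.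
Qed.

Lemma pow_lt_inv (N : nat) (x y : R) : 0 <= x -> x ^ N < y ^ N -> 0 <= y -> x < y.
Proof.
  intros Hx H Hy. destruct (Rle_or_lt y x) as [Hle|]; [|assumption].
  assert (y ^ N <= x ^ N) by now apply pow_incr. lra.
Qed.

Lemma root_le (N : nat) (x y : R) : (1 <= N)%nat -> x <= y -> root N x <= root N y.
Proof.
  intros HN Hxy. destruct (Rle_or_lt x 0) as [H|H].
  - unfold root at 1. destruct (Rle_dec x 0); [apply root_nonneg|lra].
  - apply pow_le_inv with N; [exact HN|apply root_nonneg|]. rewrite !root_pow; lra || lia.
Qed.

Lemma root_lt (N : nat) (x y : R) : (1 <= N)%nat -> 0 <= x -> x < y -> root N x < root N y.
Proof.
  intros HN Hx Hxy. apply pow_lt_inv with N; try apply root_nonneg. rewrite !root_pow; lra || lia.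
Qed.

Lemma root_unique (N : nat) (x y : R) : (1 <= N)%nat -> 0 <= y -> y ^ N = x -> root N x = y.
Proof.
  intros HN Hy E. assert (0 <= x) by (rewrite <- E; now apply pow_le).
  apply Rle_antisym; apply pow_le_inv with N; auto; try apply root_nonneg; rewrite root_pow; lra || auto.
Qed.

Lemma derivable_pt_lim_root (N : nat) (x : R) : (1 <= N)%nat -> 0 < x ->
  derivable_pt_lim (root N) x (/ (INR N * root N x ^ (N - 1))).
Proof.
  intros HN Hx.
  assert (HI : 0 < INR N) by (apply lt_0_INR; lia).
  apply derivable_pt_lim_local with (fun y => Rpower y (/ INR N)) x; [exact Hx| |].
  - intros y Hy. apply Rabs_def2 in Hy. unfold root. destruct (Rle_dec y 0); [lra|reflexivity].
  - replace (/ (INR N * root N x ^ (N - 1))) with (/ INR N * Rpower x (/ INR N - 1)).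
    + now apply derivable_pt_lim_power.
    + unfold root. destruct (Rle_dec x 0); [lra|]. rewrite Rinv_mult. f_equal.
      rewrite <- Rpower_pow by apply exp_pos. rewrite Rpower_mult, <- Rpower_Ropp. f_equal.
      rewrite minus_INR by lia. simpl. field. lra.
Qed.

(** The value [0] at nonpositive arguments makes the root continuous on the whole line, so an Euler
    step depends continuously on its data with no sign condition on [J]. *)
Lemma continuity_root (N : nat) : (1 <= N)%nat -> continuity (root N).
Proof.
  intros HN x. destruct (Rle_or_lt x 0) as [Hx|Hx].
  - apply continuity_pt_eps. intros eps He. exists (eps ^ N). split; [now apply pow_lt|].
    intros y Hy. replace (root N x) with 0 by (unfold root; destruct (Rle_dec x 0); lra).
    rewrite Rminus_0_r, Rabs_right by (apply Rle_ge, root_nonneg).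
    destruct (Rle_or_lt y 0) as [Hy0|Hy0].
    + unfold root; destruct (Rle_dec y 0); lra.
    + apply pow_lt_inv with N; [apply root_nonneg| |lra]. rewrite root_pow by (lra || lia).
      apply Rabs_def2 in Hy. lra.
  - apply derivable_continuous_pt. eexists. now apply derivable_pt_lim_root.
Qed.

(** * Compactness: common cluster points and an Ascoli argument *)

Lemma bolzano_weierstrass_subseq (u : nat -> R) (C : R) :
  (forall n, Rabs (u n) <= C) ->
  exists (sigma : nat -> nat) (l : R), forall k, (k <= sigma k)%nat /\ Rabs (u (sigma k) - l) < / (INR k + 1).
Proof.
  intros H.
  destruct (Bolzano_Weierstrass u (fun c => -C <= c <= C)) as [l Hl].
  - apply compact_P3.
  - intros n. specialize (H n). unfold Rabs in H; destruct (Rcase_abs (u n)); lra.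
  - assert (E : forall k, exists n, (k <= n)%nat /\ Rabs (u n - l) < / (INR k + 1)).
    { intros k. assert (Hp : 0 < / (INR k + 1)) by (apply Rinv_0_lt_compat; pose proof (pos_INR k); lra).
      destruct (Hl (disc l (mkposreal _ Hp)) k) as [p [Hp1 Hp2]].
      - exists (mkposreal _ Hp). now intros y Hy.
      - exists p; split; [exact Hp1|exact Hp2]. }
    exists (fun k => proj1_sig (constructive_indefinite_description _ (E k))), l.
    intros k. exact (proj2_sig (constructive_indefinite_description _ (E k))).
Qed.

Lemma inv_INR_small (eps : R) : 0 < eps -> exists k0, forall k, (k0 <= k)%nat -> / (INR k + 1) < eps.
Proof.
  intros He. destruct (archimed_cor1 eps He) as [n [H1 H2]]. exists n. intros k Hk.
  eapply Rle_lt_trans; [|exact H1]. apply Rinv_le_contravar.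
  - apply lt_0_INR; lia.
  - apply le_INR in Hk. lra.
Qed.

(** A diagonal argument without a diagonal sequence: only finitely many coordinates are ever needed
    at once, because a finite net controls uniform distance. So for coordinates up to [K] a late
    term of the [K+1]-st nested subsequence is enough. *)
Lemma common_cluster_sequence (x : nat -> nat -> R) (C : R) :
  (forall n i, Rabs (x n i) <= C) ->
  exists l : nat -> R, forall K m eps, 0 < eps ->
    exists n, (m <= n)%nat /\ forall i, (i <= K)%nat -> Rabs (x n i - l i) < eps.
Proof.
  intros H.
  pose (step := fun (K : nat) (s : nat -> nat) =>
    constructive_indefinite_description _
      (bolzano_weierstrass_subseq (fun k => x (s k) K) C (fun k => H (s k) K))).
  pose (st := fix st K := match K with
     | O => fun k : nat => k
     | S K' => fun k => st K' (proj1_sig (step K' (st K')) k) end).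
  assert (Hst : forall K k, (k <= st K k)%nat).
  { induction K as [|K IH]; intros k; [simpl; lia|]. cbn [st].
    destruct (step K (st K)) as [sg [l Hl]]; cbn. specialize (IH (sg k)). specialize (Hl k). lia. }
  assert (Hl : forall K, exists l, forall k, Rabs (x (st (S K) k) K - l) < / (INR k + 1)).
  { intros K. cbn [st]. destruct (step K (st K)) as [sg [l Hl]]; cbn. exists l. intros k; apply Hl. }
  pose (l := fun K => proj1_sig (constructive_indefinite_description _ (Hl K))).
  assert (Hl' : forall K k, Rabs (x (st (S K) k) K - l K) < / (INR k + 1)).
  { intros K. unfold l. destruct (constructive_indefinite_description _ (Hl K)); assumption. }
  (* Every deeper refinement is a subsequence of the [i+1]-st one, at an index [k' >= k]. The error
     bound [1/(k'+1)] for coordinate [i] therefore survives all later refinements. *)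
  assert (Hext : forall d i k, exists k', (k <= k')%nat /\ st (d + S i)%nat k = st (S i) k').
  { induction d as [|d IH]; intros i k; [now exists k|].
    change (S d + S i)%nat with (S (d + S i)). cbn [st].
    destruct (step (d + S i)%nat (st (d + S i)%nat)) as [sg [l' Hl2]]; cbn.
    destruct (IH i (sg k)) as [k' [Hk1 Hk2]]. exists k'. split; [|exact Hk2]. specialize (Hl2 k). lia. }
  exists l. intros K m eps He. destruct (inv_INR_small eps He) as [k0 Hk0].
  exists (st (S K) (max m k0)). split.
  - specialize (Hst (S K) (max m k0)). lia.
  - intros i Hi. destruct (Hext (K - i)%nat i (max m k0)) as [k' [Hk1 Hk2]].
    replace (K - i + S i)%nat with (S K) in Hk2 by lia. rewrite Hk2.
    eapply Rlt_trans; [apply Hl'|]. apply Hk0. lia.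
Qed.

Definition rat01 (k : nat) : R :=
  let (i, p) := Cantor.of_nat k in Rmin 1 (INR i / (INR p + 1)).

Lemma rat01_bounds (k : nat) : 0 <= rat01 k <= 1.
Proof.
  unfold rat01. destruct (Cantor.of_nat k) as [i p]. split; [|apply Rmin_l].
  apply Rmin_glb; [lra|]. pose proof (pos_INR i). pose proof (pos_INR p).
  apply Rmult_le_pos; [lra|]. apply Rlt_le, Rinv_0_lt_compat; lra.
Qed.

Definition nfloor (x : R) : nat := Z.to_nat (Int_part x).

Lemma nfloor_spec (x : R) : 0 <= x -> INR (nfloor x) <= x < INR (nfloor x) + 1.
Proof.
  intros Hx. unfold nfloor. destruct (base_Int_part x) as [H1 H2].
  assert (0 <= Int_part x)%Z.
  { assert (-1 < Int_part x)%Z; [|lia]. apply lt_IZR. lra. }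
  rewrite INR_IZR_INZ, Z2Nat.id by assumption. lra.
Qed.

Lemma nfloor_unique (x : R) (n : nat) : INR n <= x < INR n + 1 -> nfloor x = n.
Proof.
  intros Hn. assert (0 <= x) by (pose proof (pos_INR n); lra).
  destruct (nfloor_spec x H) as [H1 H2].
  assert (nfloor x < S n)%nat by (apply INR_lt; rewrite S_INR; lra).
  assert (n < S (nfloor x))%nat by (apply INR_lt; rewrite S_INR; lra). lia.
Qed.

Lemma nfloor_INR (n : nat) : nfloor (INR n) = n.
Proof. apply nfloor_unique; lra. Qed.

Lemma nfloor_le (x y : R) : 0 <= x <= y -> (nfloor x <= nfloor y)%nat.
Proof.
  intros H. destruct (nfloor_spec x) as [H1 H2]; [lra|]. destruct (nfloor_spec y) as [H3 H4]; [lra|].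
  assert (nfloor x < S (nfloor y))%nat by (apply INR_lt; rewrite S_INR; lra). lia.
Qed.

Lemma rat01_net (p : nat) : exists K, forall r, 0 <= r <= 1 ->
  exists i, (i <= K)%nat /\ Rabs (r - rat01 i) <= / (INR p + 1).
Proof.
  assert (Hb : forall j, exists K, forall i, (i <= j)%nat -> (Cantor.to_nat (i, p) <= K)%nat).
  { induction j as [|j [K IH]].
    - exists (Cantor.to_nat (0%nat, p)). intros i Hi. now replace i with 0%nat by lia.
    - exists (max K (Cantor.to_nat (S j, p))). intros i Hi.
      destruct (Nat.eq_dec i (S j)) as [->|Hne]; [lia|]. specialize (IH i ltac:(lia)). lia. }
  destruct (Hb (S p)) as [K HK]. exists K. intros r Hr.
  pose proof (pos_INR p) as Hp.
  destruct (nfloor_spec (r * (INR p + 1))) as [H1 H2]; [apply Rmult_le_pos; lra|].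
  set (i := nfloor (r * (INR p + 1))) in *.
  assert (Hi : INR i <= INR p + 1) by nra.
  exists (Cantor.to_nat (i, p)). split.
  - apply HK. apply INR_le. rewrite S_INR; lra.
  - unfold rat01. rewrite Cantor.cancel_of_to.
    rewrite Rmin_right by (apply Rmult_le_reg_r with (INR p + 1); [lra|]; unfold Rdiv; rewrite Rmult_assoc, Rinv_l; lra).
    replace (r - INR i / (INR p + 1)) with ((r * (INR p + 1) - INR i) * / (INR p + 1)) by (field; lra).
    assert (0 < / (INR p + 1)) by (apply Rinv_0_lt_compat; lra).
    rewrite Rabs_right by (apply Rle_ge, Rmult_le_pos; lra).
    rewrite <- (Rmult_1_l (/ (INR p + 1))) at 2. apply Rmult_le_compat_r; lra.
Qed.

Lemma rat01_dense (r d : R) : 0 <= r <= 1 -> 0 < d -> exists i, Rabs (r - rat01 i) < d.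
Proof.
  intros Hr Hd. destruct (inv_INR_small d Hd) as [p Hp]. destruct (rat01_net p) as [K HK].
  destruct (HK r Hr) as [i [_ Hi]]. exists i. specialize (Hp p (le_n p)). lra.
Qed.

(* The limit is first found on the rationals; it is Lipschitz there and is extended to [0,1]
   by a supremum of cones. *)
Lemma ascoli_asymptotically_lipschitz (F : nat -> R -> R) (C : R) : 0 < C ->
  (forall k r, 0 <= r <= 1 -> Rabs (F k r) <= C) ->
  (forall k r s, 0 <= r <= 1 -> 0 <= s <= 1 ->
     Rabs (F k r - F k s) <= C * Rabs (r - s) + C * / (INR k + 1)) ->
  exists (L : R -> R) (phi : nat -> nat), cont_on01 L /\
    forall k, (k <= phi k)%nat /\
      forall r, 0 <= r <= 1 -> Rabs (F (phi k) r - L r) <= / (INR k + 1).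
Proof.
  intros HC Hbd Hlip.
  destruct (common_cluster_sequence (fun n i => F n (rat01 i)) C) as [l Hl].
  { intros n i; apply Hbd, rat01_bounds. }
  assert (Hll : forall i j, l i - l j <= C * Rabs (rat01 i - rat01 j)).
  { intros i j. apply Rnot_lt_le. intros Hlt.
    (* Four units of [eta] are in excess, while approximating [l i], approximating [l j] and the
       defect [C/(n+1)] cost less than three. *)
    set (eta := (l i - l j - C * Rabs (rat01 i - rat01 j)) / 4).
    assert (Heta : 0 < eta) by (unfold eta; lra).
    destruct (inv_INR_small (eta / C)) as [m Hm]; [now apply Rdiv_lt_0_compat|].
    destruct (Hl (max i j) m eta Heta) as [n [Hn Hn']].
    pose proof (Hn' i ltac:(lia)) as A1. pose proof (Hn' j ltac:(lia)) as A2.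
    pose proof (Hlip n _ _ (rat01_bounds i) (rat01_bounds j)) as A3.
    specialize (Hm n Hn). apply Rmult_lt_compat_l with (r := C) in Hm; [|exact HC].
    replace (C * (eta / C)) with eta in Hm by (field; lra).
    apply Rabs_def2 in A1. apply Rabs_def2 in A2.
    pose proof (Rle_abs (F n (rat01 i) - F n (rat01 j))). unfold eta in *. lra. }
  assert (HL : forall r, exists L, forall i, Rabs (L - l i) <= C * Rabs (r - rat01 i)).
  { intros r.
    destruct (completeness (fun y => exists i, y = l i - C * Rabs (r - rat01 i))) as [L [HL1 HL2]].
    - exists (l 0%nat + C * Rabs (r - rat01 0)). intros y [i ->]. specialize (Hll i 0%nat).
      assert (C * Rabs (rat01 i - rat01 0) <= C * (Rabs (r - rat01 i) + Rabs (r - rat01 0))); [|lra].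
      apply Rmult_le_compat_l; [lra|].
      replace (rat01 i - rat01 0) with ((r - rat01 0) - (r - rat01 i)) by ring.
      unfold Rminus at 1. eapply Rle_trans; [apply Rabs_triang|]. rewrite Rabs_Ropp. lra.
    - now exists (l 0%nat - C * Rabs (r - rat01 0)), 0%nat.
    - exists L. intros i. apply Rabs_le. split.
      + specialize (HL1 _ (ex_intro _ i eq_refl)). lra.
      + assert (L <= l i + C * Rabs (r - rat01 i)); [|lra].
        apply HL2. intros y [j ->]. specialize (Hll j i).
        assert (C * Rabs (rat01 j - rat01 i) <= C * (Rabs (r - rat01 j) + Rabs (r - rat01 i))); [|lra].
        apply Rmult_le_compat_l; [lra|].
        replace (rat01 j - rat01 i) with ((r - rat01 i) - (r - rat01 j)) by ring.
        unfold Rminus at 1. eapply Rle_trans; [apply Rabs_triang|]. rewrite Rabs_Ropp. lra. }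
  pose (L := fun r => proj1_sig (constructive_indefinite_description _ (HL r))).
  assert (HL' : forall r i, Rabs (L r - l i) <= C * Rabs (r - rat01 i)).
  { intros r. unfold L. destruct (constructive_indefinite_description _ (HL r)); assumption. }
  assert (Hunif : forall k, exists n, (k <= n)%nat /\
            forall r, 0 <= r <= 1 -> Rabs (F n r - L r) <= / (INR k + 1)).
  { intros k. assert (Hk : 0 < / (INR k + 1)) by (apply Rinv_0_lt_compat; pose proof (pos_INR k); lra).
    set (e := / (INR k + 1)) in *.
    destruct (inv_INR_small (e / 4 / C)) as [m Hm]; [apply Rdiv_lt_0_compat; lra|].
    assert (Hm' : forall n, (m <= n)%nat -> C * / (INR n + 1) < e / 4).
    { intros n Hn. specialize (Hm n Hn). apply Rmult_lt_compat_l with (r := C) in Hm; [|exact HC].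
      now replace (C * (e / 4 / C)) with (e / 4) in Hm by (field; lra). }
    destruct (rat01_net m) as [K HK].
    (* The quarters of [e] pay for the Lipschitz term and the defect between [r] and its net point,
       for the cluster approximation there, and for the Lipschitz bound on [L]. *)
    destruct (Hl K (max k m) (e / 4)) as [n [Hn Hn']]; [lra|].
    exists n. split; [lia|]. intros r Hr. destruct (HK r Hr) as [i [Hi1 Hi2]].
    specialize (Hn' i Hi1). pose proof (Hlip n r _ Hr (rat01_bounds i)) as A.
    pose proof (HL' r i) as B. pose proof (Hm' n ltac:(lia)). pose proof (Hm' m (le_n m)).
    apply Rmult_le_compat_l with (r := C) in Hi2; [|lra].
    replace (F n r - L r) with ((F n r - F n (rat01 i)) + ((F n (rat01 i) - l i) + - (L r - l i))) by ring.
    eapply Rle_trans; [apply Rabs_triang|]. eapply Rle_trans; [apply Rplus_le_compat_l, Rabs_triang|].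
    rewrite Rabs_Ropp. lra. }
  exists L, (fun k => proj1_sig (constructive_indefinite_description _ (Hunif k))). split.
  - intros r Hr eps He. exists (eps / (4 * C)). split; [apply Rdiv_lt_0_compat; lra|].
    intros s Hs Hsr. destruct (rat01_dense r (eps / (4 * C)) Hr) as [i Hi]; [apply Rdiv_lt_0_compat; lra|].
    pose proof (HL' r i) as A1. pose proof (HL' s i) as A2.
    assert (B1 : C * Rabs (r - rat01 i) < eps / 4).
    { apply Rmult_lt_compat_l with (r := C) in Hi; [|exact HC].
      now replace (C * (eps / (4 * C))) with (eps / 4) in Hi by (field; lra). }
    assert (B2 : C * Rabs (s - r) < eps / 4).
    { apply Rmult_lt_compat_l with (r := C) in Hsr; [|exact HC].
      now replace (C * (eps / (4 * C))) with (eps / 4) in Hsr by (field; lra). }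
    assert (B3 : C * Rabs (s - rat01 i) <= C * (Rabs (s - r) + Rabs (r - rat01 i))).
    { apply Rmult_le_compat_l; [lra|]. replace (s - rat01 i) with ((s - r) + (r - rat01 i)) by ring.
      apply Rabs_triang. }
    replace (L s - L r) with ((L s - l i) + - (L r - l i)) by ring.
    eapply Rle_lt_trans; [apply Rabs_triang|]. rewrite Rabs_Ropp. lra.
  - intros k. exact (proj2_sig (constructive_indefinite_description _ (Hunif k))).
Qed.

(** * Stieltjes recursions on a uniform grid and their limits *)

Lemma Rabs_le_inv (a b : R) : Rabs a <= b -> - b <= a <= b.
Proof. unfold Rabs; destruct (Rcase_abs a); lra. Qed.

(** Piecewise constant interpolation returns the discrete values exactly at the nodes. Its jumps are
    of the order of the mesh, which is why the Ascoli lemma tolerates a defect [C/(k+1)] in the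
    Lipschitz bound. *)
Definition step_fun (n : nat) (y : nat -> R) (r : R) : R := y (nfloor (r * (INR n + 1))).

Definition grid (n k : nat) : R := INR k / (INR n + 1).

Lemma grid_nfloor (n : nat) (r : R) : 0 <= r <= 1 ->
  r - / (INR n + 1) < grid n (nfloor (r * (INR n + 1))) <= r.
Proof.
  intros Hr. pose proof (pos_INR n).
  destruct (nfloor_spec (r * (INR n + 1))) as [H1 H2]; [apply Rmult_le_pos; lra|].
  set (i := nfloor _) in *. unfold grid.
  split; apply Rmult_lt_reg_r with (INR n + 1) || apply Rmult_le_reg_r with (INR n + 1); try lra.
  - replace ((r - / (INR n + 1)) * (INR n + 1)) with (r * (INR n + 1) - 1) by (field; lra).
    replace (INR i / (INR n + 1) * (INR n + 1)) with (INR i) by (field; lra). lra.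
  - replace (INR i / (INR n + 1) * (INR n + 1)) with (INR i) by (field; lra). lra.
Qed.

Lemma step_fun_grid (n k : nat) (y : nat -> R) : step_fun n y (grid n k) = y k.
Proof.
  unfold step_fun, grid. f_equal. pose proof (pos_INR n).
  replace (INR k / (INR n + 1) * (INR n + 1)) with (INR k) by (field; lra). apply nfloor_INR.
Qed.

Lemma grid_le (n i j : nat) : (i <= j)%nat -> grid n i <= grid n j.
Proof.
  intros H. apply le_INR in H. unfold grid. apply Rmult_le_compat_r; [|exact H].
  apply Rlt_le, Rinv_0_lt_compat. pose proof (pos_INR n); lra.
Qed.

Lemma grid_nonneg (n k : nat) : 0 <= grid n k.
Proof. replace 0 with (grid n 0) by (unfold grid; simpl; lra). apply grid_le; lia. Qed.

Lemma grid_end (n : nat) : grid n (S n) = 1.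
Proof. unfold grid. rewrite S_INR. pose proof (pos_INR n). field; lra. Qed.

Lemma stieltjes_sum_bounds (p y z : nat -> R) (i j : nat) (m M : R) :
  (forall k, p k <= p (S k)) ->
  (forall k, y (S k) = y k + (p (S k) - p k) * z k) ->
  (i <= j)%nat -> (forall l, (i <= l < j)%nat -> m <= z l <= M) ->
  (p j - p i) * m <= y j - y i <= (p j - p i) * M.
Proof.
  intros Hp Hy Hij. induction Hij as [|j Hij IH]; intros Hz; [lra|].
  destruct IH as [I1 I2]; [intros l Hl; apply Hz; lia|].
  rewrite Hy. specialize (Hz j ltac:(lia)). specialize (Hp j).
  assert ((p (S j) - p j) * m <= (p (S j) - p j) * z j) by (apply Rmult_le_compat_l; lra).
  assert ((p (S j) - p j) * z j <= (p (S j) - p j) * M) by (apply Rmult_le_compat_l; lra).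
  lra.
Qed.

(** Monotonicity is asked on the whole half-line because the recursions run over all indices, also
    past the node [1]. The Lipschitz bound is confined to [[0,1]], where it holds for [t^N] with
    constant [N]. *)
Definition lip_increasing (phi : R -> R) (L : R) : Prop :=
  forall x y, 0 <= x -> x <= y -> phi x <= phi y /\ (y <= 1 -> phi y - phi x <= L * (y - x)).

(** Discrete form of [dy = z dphi], with the integrand taken at the left node. *)
Definition stieltjes_rec (n : nat) (phi : R -> R) (y z : nat -> R) : Prop :=
  forall k, y (S k) = y k + (phi (grid n (S k)) - phi (grid n k)) * z k.

Lemma stieltjes_rec_bounds (n : nat) (phi : R -> R) (L : R) (y z : nat -> R) (i j : nat) (m M : R) :
  lip_increasing phi L -> stieltjes_rec n phi y z ->
  (i <= j)%nat -> (forall l, (i <= l < j)%nat -> m <= z l <= M) ->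
  (phi (grid n j) - phi (grid n i)) * m <= y j - y i <= (phi (grid n j) - phi (grid n i)) * M.
Proof.
  intros Hphi Hy. apply (stieltjes_sum_bounds (fun k => phi (grid n k))); [|exact Hy].
  intros k. apply Hphi; [apply grid_nonneg|apply grid_le; lia].
Qed.

Lemma step_fun_lipschitz (n : nat) (phi : R -> R) (L B : R) (y z : nat -> R) :
  0 <= L -> 0 <= B -> lip_increasing phi L -> stieltjes_rec n phi y z ->
  (forall l, (l <= n)%nat -> Rabs (z l) <= B) ->
  forall r s, 0 <= r <= 1 -> 0 <= s <= 1 ->
    Rabs (step_fun n y r - step_fun n y s) <= B * L * Rabs (r - s) + B * L * / (INR n + 1).
Proof.
  intros HL HB Hphi Hy Hz.
  assert (Hord : forall r s, 0 <= r <= s -> s <= 1 ->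
    Rabs (step_fun n y s - step_fun n y r) <= B * L * (s - r) + B * L * / (INR n + 1)).
  { intros r s Hr Hs. unfold step_fun. pose proof (pos_INR n).
    destruct (grid_nfloor n r) as [R1 R2]; [lra|]. destruct (grid_nfloor n s) as [S1 S2]; [lra|].
    assert (Hij : (nfloor (r * (INR n + 1)) <= nfloor (s * (INR n + 1)))%nat).
    { apply nfloor_le. split; [apply Rmult_le_pos|apply Rmult_le_compat_r]; lra. }
    assert (Hj : (nfloor (s * (INR n + 1)) <= S n)%nat).
    { rewrite <- (nfloor_INR (S n)), S_INR. apply nfloor_le.
      split; [apply Rmult_le_pos; lra|]. rewrite <- (Rmult_1_l (INR n + 1)) at 2.
      apply Rmult_le_compat_r; lra. }
    set (i := nfloor (r * _)) in *. set (j := nfloor (s * _)) in *.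
    destruct (stieltjes_rec_bounds n phi L y z i j (- B) B Hphi Hy Hij) as [B1 B2].
    { intros l Hl. specialize (Hz l ltac:(lia)). apply Rabs_le_inv in Hz. lra. }
    destruct (Hphi (grid n i) (grid n j) (grid_nonneg n i) (grid_le n i j Hij)) as [P1 P2].
    specialize (P2 ltac:(lra)).
    apply Rle_trans with (B * (L * (grid n j - grid n i))).
    - apply Rle_trans with (B * (phi (grid n j) - phi (grid n i))).
      + apply Rabs_le. lra.
      + now apply Rmult_le_compat_l.
    - replace (B * L * (s - r) + B * L * / (INR n + 1)) with (B * (L * (s - r + / (INR n + 1)))) by ring.
      apply Rmult_le_compat_l; [exact HB|]. apply Rmult_le_compat_l; [exact HL|]. lra. }
  intros r s Hr Hs. destruct (Rle_or_lt r s).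
  - rewrite Rabs_minus_sym, (Rabs_minus_sym r s), (Rabs_right (s - r)) by lra. apply Hord; lra.
  - rewrite (Rabs_right (r - s)) by lra. apply Hord; lra.
Qed.

Definition unif_cv01 (F : nat -> R -> R) (L : R -> R) : Prop :=
  forall eps, 0 < eps -> exists m, forall k, (m <= k)%nat ->
    forall r, 0 <= r <= 1 -> Rabs (F k r - L r) <= eps.

(** The integral equation in local form. Near [r] all nodal values of [x] are close to [X r], so the
    integrand [H x] stays within [eta] of [H (X r)]. Summation keeps this bound, and rounding [p]
    and [q] to nodes costs nothing in the limit. Continuity of [H] at the single value [X r] is what
    enters. *)
Lemma step_limit_increment (nu : nat -> nat) (phi H X Y : R -> R) (L : R) (x y : nat -> nat -> R)
    (r eta : R) :
  (forall k, (k <= nu k)%nat) -> 0 <= L -> lip_increasing phi L -> continuity H ->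
  (forall k, stieltjes_rec (nu k) phi (y k) (fun l => H (x k l))) ->
  unif_cv01 (fun k => step_fun (nu k) (x k)) X -> unif_cv01 (fun k => step_fun (nu k) (y k)) Y ->
  cont_on01 X -> 0 <= r <= 1 -> 0 < eta ->
  exists delta, 0 < delta /\ forall p q, 0 <= p <= q -> q <= 1 ->
    Rabs (p - r) < delta -> Rabs (q - r) < delta ->
    Rabs (Y q - Y p - (phi q - phi p) * H (X r)) <= eta * (phi q - phi p).
Proof.
  intros Hnu HL Hphi HH Hrec HX HY HXc Hr Heta.
  destruct (proj1 (continuity_pt_eps H (X r)) (HH (X r)) eta Heta) as [d0 [Hd0 HH']].
  destruct (HXc r Hr (d0 / 2) ltac:(lra)) as [d1 [Hd1 HX']].
  exists d1. split; [exact Hd1|]. intros p q Hp Hq Hpr Hqr.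
  set (c := H (X r)) in *. apply le_epsilon. intros e He.
  (* With [e' = e/T], the two errors in [Y] cost [2 e'], and rounding [phi] at [p] and [q] costs at
     most [(L+1) e' (|c| + eta)]. Together they stay below [e]. *)
  set (T := 2 * (1 + (L + 1) * (Rabs c + eta))).
  assert (HT : 0 < T).
  { unfold T. pose proof (Rabs_pos c). assert (0 <= (L + 1) * (Rabs c + eta)) by (apply Rmult_le_pos; lra). lra. }
  set (e' := e / T).
  assert (He' : 0 < e') by (now apply Rdiv_lt_0_compat).
  destruct (HX (d0 / 4) ltac:(lra)) as [m1 Hm1].
  destruct (HY e' He') as [m2 Hm2].
  destruct (inv_INR_small e' He') as [m3 Hm3].
  (* The node preceding [p] may lie to the left of [p]. This mesh size keeps it to the right of
     [r - d1], where [X] is still close to [X r]. *)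
  destruct (inv_INR_small (p - r + d1)) as [m4 Hm4]; [apply Rabs_def2 in Hpr; lra|].
  set (k := max (max m1 m2) (max m3 m4)).
  specialize (Hm1 k ltac:(lia)). specialize (Hm2 k ltac:(lia)).
  specialize (Hnu k). set (n := nu k) in *.
  specialize (Hm3 n ltac:(lia)). specialize (Hm4 n ltac:(lia)).
  pose proof (pos_INR n) as Hn0.
  destruct (grid_nfloor n p) as [R1 R2]; [lra|]. destruct (grid_nfloor n q) as [S1 S2]; [lra|].
  pose proof (Hm2 p ltac:(lra)) as Yp. pose proof (Hm2 q ltac:(lra)) as Yq.
  unfold step_fun in Yp, Yq.
  assert (Hij : (nfloor (p * (INR n + 1)) <= nfloor (q * (INR n + 1)))%nat).
  { apply nfloor_le. split; [apply Rmult_le_pos|apply Rmult_le_compat_r]; lra. }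
  set (i := nfloor (p * _)) in *. set (j := nfloor (q * _)) in *.
  destruct (stieltjes_rec_bounds n phi L (y k) _ i j (c - eta) (c + eta) Hphi (Hrec k) Hij) as [B1 B2].
  { intros l Hl.
    assert (G1 := grid_le n i l ltac:(lia)). assert (G2 := grid_le n l j ltac:(lia)).
    assert (Hg : 0 <= grid n l <= 1) by (pose proof (grid_nonneg n l); lra).
    apply Rabs_def2 in Hpr. apply Rabs_def2 in Hqr.
    specialize (HX' (grid n l) Hg ltac:(apply Rabs_def1; lra)).
    specialize (Hm1 (grid n l) Hg). rewrite step_fun_grid in Hm1.
    assert (A : Rabs (x k l - X r) < d0).
    { replace (x k l - X r) with ((x k l - X (grid n l)) + (X (grid n l) - X r)) by ring.
      eapply Rle_lt_trans; [apply Rabs_triang|]. lra. }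
    specialize (HH' _ A). apply Rabs_def2 in HH'. fold c in HH'. lra. }
  assert (Pp := Hphi (grid n i) p (grid_nonneg n i) R2). destruct Pp as [Pp1 Pp2]. specialize (Pp2 ltac:(lra)).
  assert (Pq := Hphi (grid n j) q (grid_nonneg n j) S2). destruct Pq as [Pq1 Pq2]. specialize (Pq2 ltac:(lra)).
  assert (Gp : phi p - phi (grid n i) <= (L + 1) * e').
  { eapply Rle_trans; [exact Pp2|]. apply Rmult_le_compat; lra. }
  assert (Gq : phi q - phi (grid n j) <= (L + 1) * e').
  { eapply Rle_trans; [exact Pq2|]. apply Rmult_le_compat; lra. }
  set (D := phi (grid n j) - phi (grid n i)) in *.
  set (D' := phi q - phi p).
  assert (HD : Rabs (D - D') <= (L + 1) * e').
  { unfold D, D'. apply Rabs_le. lra. }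
  assert (HDc : Rabs (y k j - y k i - D * c) <= eta * D) by (apply Rabs_le; lra).
  replace (Y q - Y p - D' * c) with
    (- (y k j - Y q) + ((y k i - Y p) + ((y k j - y k i - D * c) + (D - D') * c))) by ring.
  eapply Rle_trans; [apply Rabs_triang|]. rewrite Rabs_Ropp.
  eapply Rle_trans; [apply Rplus_le_compat_l, Rabs_triang|].
  eapply Rle_trans; [apply Rplus_le_compat_l, Rplus_le_compat_l, Rabs_triang|].
  rewrite Rabs_mult.
  assert (E1 : Rabs (D - D') * Rabs c <= (L + 1) * e' * Rabs c)
    by (apply Rmult_le_compat_r; [apply Rabs_pos|exact HD]).
  assert (E2 : eta * D <= eta * D' + eta * ((L + 1) * e')).
  { rewrite <- Rmult_plus_distr_l. apply Rmult_le_compat_l; [lra|]. apply Rabs_le_inv in HD. lra. }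
  assert (E3 : e = T * e') by (unfold e'; field; lra).
  assert (0 <= (L + 1) * e' * (Rabs c + eta)).
  { pose proof (Rabs_pos c). apply Rmult_le_pos; [apply Rmult_le_pos|]; lra. }
  unfold T in E3. lra.
Qed.

Lemma step_limit_derivative (nu : nat -> nat) (phi H X Y : R -> R) (L : R) (x y : nat -> nat -> R)
    (r dphi : R) :
  (forall k, (k <= nu k)%nat) -> 0 <= L -> lip_increasing phi L -> continuity H ->
  (forall k, stieltjes_rec (nu k) phi (y k) (fun l => H (x k l))) ->
  unif_cv01 (fun k => step_fun (nu k) (x k)) X -> unif_cv01 (fun k => step_fun (nu k) (y k)) Y ->
  cont_on01 X -> 0 < r < 1 -> derivable_pt_lim phi r dphi ->
  derivable_pt_lim Y r (dphi * H (X r)).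
Proof.
  intros Hnu HL Hphi HH Hrec HX HY HXc Hr Hd eps He.
  set (c := H (X r)).
  set (eta := eps / (2 * (L + 1))).
  assert (Heta : 0 < eta) by (apply Rdiv_lt_0_compat; lra).
  destruct (step_limit_increment nu phi H X Y L x y r eta) as [d1 [Hd1 Hinc]]; auto; [lra|].
  fold c in Hinc.
  pose proof (Rabs_pos c) as Hc.
  destruct (Hd (eps / (2 * (Rabs c + 1))) ltac:(apply Rdiv_lt_0_compat; lra)) as [[d2 Hd2] Hd'].
  simpl in Hd'.
  assert (Hm : 0 < Rmin (Rmin d1 d2) (Rmin r (1 - r))) by (repeat apply Rmin_pos; lra).
  exists (mkposreal _ Hm). simpl. intros h Hh Hlt.
  assert (H1 := Rlt_le_trans _ _ _ Hlt (Rmin_l _ _)).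
  assert (H2 := Rlt_le_trans _ _ _ Hlt (Rmin_r _ _)).
  assert (H3 := Rlt_le_trans _ _ _ H2 (Rmin_l _ _)).
  assert (H4 := Rlt_le_trans _ _ _ H2 (Rmin_r _ _)).
  assert (H5 := Rlt_le_trans _ _ _ H1 (Rmin_l _ _)).
  assert (H6 := Rlt_le_trans _ _ _ H1 (Rmin_r _ _)).
  specialize (Hd' h Hh H6). clear Hlt H1 H2 H6.
  apply Rabs_def2 in H3. apply Rabs_def2 in H4.
  assert (Habs : 0 < Rabs h) by now apply Rabs_pos_lt.
  assert (Hmain : Rabs (Y (r + h) - Y r - (phi (r + h) - phi r) * c) <= eta * (L * Rabs h)).
  { destruct (Rlt_or_le h 0) as [Hn|Hn].
    - destruct (Hphi (r + h) r) as [P1 P2]; try lra. specialize (P2 ltac:(lra)).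
      specialize (Hinc (r + h) r ltac:(lra) ltac:(lra)).
      replace (r + h - r) with h in Hinc by ring.
      rewrite Rminus_diag, Rabs_R0 in Hinc. specialize (Hinc H5 Hd1).
      rewrite <- Rabs_Ropp. replace (- (Y (r + h) - Y r - (phi (r + h) - phi r) * c)) with
        (Y r - Y (r + h) - (phi r - phi (r + h)) * c) by ring.
      eapply Rle_trans; [exact Hinc|]. apply Rmult_le_compat_l; [lra|]. rewrite Rabs_left by lra. lra.
    - destruct (Hphi r (r + h)) as [P1 P2]; try lra. specialize (P2 ltac:(lra)).
      specialize (Hinc r (r + h) ltac:(lra) ltac:(lra)).
      replace (r + h - r) with h in Hinc by ring.
      rewrite Rminus_diag, Rabs_R0 in Hinc. specialize (Hinc Hd1 H5).
      eapply Rle_trans; [exact Hinc|]. apply Rmult_le_compat_l; [lra|]. rewrite Rabs_right by lra. lra. }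
  replace ((Y (r + h) - Y r) / h - dphi * c) with
    ((Y (r + h) - Y r - (phi (r + h) - phi r) * c) / h + ((phi (r + h) - phi r) / h - dphi) * c)
    by (field; exact Hh).
  eapply Rle_lt_trans; [apply Rabs_triang|].
  unfold Rdiv at 1. rewrite !Rabs_mult, Rabs_inv.
  assert (E1 : Rabs (Y (r + h) - Y r - (phi (r + h) - phi r) * c) * / Rabs h <= eta * L).
  { apply Rmult_le_reg_r with (Rabs h); [exact Habs|]. rewrite Rmult_assoc, Rinv_l by lra. lra. }
  assert (E2 : eta * L < eps / 2).
  { replace (eps / 2) with (eta * (L + 1)) by (unfold eta; field; lra). apply Rmult_lt_compat_l; lra. }
  assert (E3 : Rabs ((phi (r + h) - phi r) / h - dphi) * Rabs c <= eps / 2).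
  { replace (eps / 2) with (eps / (2 * (Rabs c + 1)) * (Rabs c + 1)) by (field; lra).
    apply Rmult_le_compat; try apply Rabs_pos; lra. }
  lra.
Qed.

(** * Euler polygons, their limits, and shooting *)

Fixpoint euler (N : nat) (G : R -> R) (lam : R) (n : nat) (a : R) (k : nat) : R * R :=
  match k with
  | O => (a, 0)
  | S k' =>
      let (w, J) := euler N G lam n a k' in
      (w + (lam * grid n (S k') - lam * grid n k') * (- root N J),
       J + (grid n (S k') ^ N - grid n k' ^ N) * G w)
  end.

Lemma euler_fst_rec (N : nat) (G : R -> R) (lam : R) (n : nat) (a : R) :
  stieltjes_rec n (fun t => lam * t) (fun k => fst (euler N G lam n a k))
    (fun k => - root N (snd (euler N G lam n a k))).
Proof. intros k. cbn [euler]. now destruct (euler N G lam n a k). Qed.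

Lemma euler_snd_rec (N : nat) (G : R -> R) (lam : R) (n : nat) (a : R) :
  stieltjes_rec n (fun t => t ^ N) (fun k => snd (euler N G lam n a k))
    (fun k => G (fst (euler N G lam n a k))).
Proof. intros k. cbn [euler]. now destruct (euler N G lam n a k). Qed.

(** For a fixed mesh the scheme is a finite composition of continuous maps. This continuity in [a]
    is what exact solutions, possibly not unique, cannot offer. *)
Lemma continuity_euler (N : nat) (G : R -> R) (lam : R) (n k : nat) :
  (1 <= N)%nat -> continuity G ->
  continuity (fun a => fst (euler N G lam n a k)) /\ continuity (fun a => snd (euler N G lam n a k)).
Proof.
  intros HN HG. induction k as [|k [IH1 IH2]].
  - split; simpl; [apply derivable_continuous, derivable_id|apply continuity_const; now intros x y].
  - assert (E : forall (u v c : R -> R) (d : R), continuity u -> continuity v ->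
              (forall a, c a = u a + d * v a) -> continuity c).
    { intros u v c d Hu Hv Hc x.
      apply continuity_pt_eps. intros eps He.
      destruct (proj1 (continuity_pt_eps _ x) (continuity_plus _ _ Hu (continuity_scal _ d Hv) x) eps He)
        as [dl [H1 H2]].
      exists dl; split; [exact H1|]. intros z Hz. rewrite !Hc. exact (H2 z Hz). }
    split.
    + apply (E _ _ _ _ IH1 (continuity_opp _ (continuity_comp _ _ IH2 (continuity_root N HN)))
               (fun a => euler_fst_rec N G lam n a k)).
    + apply (E _ _ _ _ IH2 (continuity_comp _ _ IH1 HG) (fun a => euler_snd_rec N G lam n a k)).
Qed.

Lemma lip_increasing_linear (lam : R) : 0 < lam -> lip_increasing (fun t => lam * t) lam.
Proof.
  intros Hl x y Hx Hxy. split; [apply Rmult_le_compat_l; lra|]. intros _. lra.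
Qed.

Lemma lip_increasing_pow (N : nat) : lip_increasing (fun t => t ^ N) (INR N).
Proof.
  intros x y Hx Hxy. split; [now apply pow_incr|]. intros Hy.
  induction N as [|N IH]; [simpl; lra|].
  rewrite S_INR. simpl.
  assert (0 <= x ^ N <= 1).
  { split; [now apply pow_le|]. rewrite <- (pow1 N). apply pow_incr; lra. }
  replace (y * y ^ N - x * x ^ N) with (y * (y ^ N - x ^ N) + (y - x) * x ^ N) by ring.
  assert (x ^ N <= y ^ N) by (apply pow_incr; lra).
  assert (y * (y ^ N - x ^ N) <= 1 * (y ^ N - x ^ N)) by (apply Rmult_le_compat_r; lra).
  assert ((y - x) * x ^ N <= (y - x) * 1) by (apply Rmult_le_compat_l; lra). lra.
Qed.

(* The radial equation [((-w')^N)' = lam^N N r^(N-1) G(w)] as a first-order system, with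
   [(-w')^N = lam^N J]. *)
Definition radial_sol (N : nat) (G : R -> R) (lam : R) (w J : R -> R) : Prop :=
  cont_on01 w /\ cont_on01 J /\ J 0 = 0 /\
  (forall r, 0 < r < 1 -> derivable_pt_lim w r (lam * - root N (J r))) /\
  (forall r, 0 < r < 1 -> derivable_pt_lim J r (INR N * r ^ (N - 1) * G (w r))).

Definition euler_end (N : nat) (G : R -> R) (lam : R) (n : nat) (a : R) : R :=
  fst (euler N G lam n a (S n)).

Lemma inv_INR_le (m n : nat) : (m <= n)%nat -> / (INR n + 1) <= / (INR m + 1).
Proof.
  intros H. apply le_INR in H. pose proof (pos_INR m). apply Rinv_le_contravar; lra.
Qed.

(** The bound on [G] confines [J] to [[0,B]] and the slopes to [[0, lam root(B)]], uniformly in the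
    mesh. The subsequence stays hidden: one suitable [k] for each [eps] is enough to carry closed
    conditions on the initial and end values to the limit, even though the [a k] need not
    converge. *)
Lemma euler_limit (N : nat) (G : R -> R) (B lam C : R) (nu : nat -> nat) (a : nat -> R) :
  (1 <= N)%nat -> continuity G -> (forall s, 0 <= G s <= B) -> 0 < lam ->
  (forall k, (k <= nu k)%nat) -> (forall k, Rabs (a k) <= C) ->
  exists w J, radial_sol N G lam w J /\
    forall eps, 0 < eps ->
      exists k, Rabs (w 0 - a k) <= eps /\ Rabs (w 1 - euler_end N G lam (nu k) (a k)) <= eps.
Proof.
  intros HN HG HB Hlam Hnu Ha.
  pose (ew := fun k => fun l => fst (euler N G lam (nu k) (a k) l)).
  pose (eJ := fun k => fun l => snd (euler N G lam (nu k) (a k) l)).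
  assert (HB0 : 0 <= B) by (specialize (HB 0); lra).
  assert (HC0 : 0 <= C) by (specialize (Ha 0%nat); pose proof (Rabs_pos (a 0%nat)); lra).
  assert (HIN := pos_INR N).
  assert (HJ : forall k l, (l <= S (nu k))%nat -> 0 <= eJ k l <= B).
  { intros k l Hl.
    destruct (stieltjes_rec_bounds (nu k) _ _ (eJ k) _ 0 l 0 B (lip_increasing_pow N)
      (euler_snd_rec N G lam (nu k) (a k)) ltac:(lia) (fun l _ => HB _)) as [B1 B2].
    unfold eJ in B1, B2 at 2. cbn in B1, B2. unfold grid in B1 at 2, B2 at 2. cbn in B1, B2.
    replace (0 / (INR (nu k) + 1)) with 0 in * by lra. rewrite pow_i in B1, B2 by lia.
    fold (eJ k l) in B1.
    assert (0 <= grid (nu k) l ^ N <= 1).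
    { split; [apply pow_le, grid_nonneg|]. rewrite <- (pow1 N). apply pow_incr.
      split; [apply grid_nonneg|]. rewrite <- (grid_end (nu k)). now apply grid_le. }
    assert (grid (nu k) l ^ N * B <= 1 * B) by (apply Rmult_le_compat_r; lra). lra. }
  assert (Hrt : forall k l, (l <= nu k)%nat -> Rabs (- root N (eJ k l)) <= root N B).
  { intros k l Hl. rewrite Rabs_Ropp, Rabs_right by (apply Rle_ge, root_nonneg).
    apply root_le; [exact HN|]. apply HJ; lia. }
  assert (Hinv : forall k, / (INR (nu k) + 1) <= / (INR k + 1)) by (intros k; now apply inv_INR_le).
  assert (Hone : forall k, 0 < / (INR (nu k) + 1) <= 1).
  { intros k. pose proof (pos_INR (nu k)). split; [apply Rinv_0_lt_compat; lra|].
    rewrite <- Rinv_1. apply Rinv_le_contravar; lra. }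
  assert (Hasc : forall (y z : nat -> nat -> R) (phi : R -> R) (L Bz : R),
      0 <= L -> 0 <= Bz -> lip_increasing phi L ->
      (forall k, stieltjes_rec (nu k) phi (y k) (z k)) ->
      (forall k, Rabs (y k 0%nat) <= C) ->
      (forall k l, (l <= nu k)%nat -> Rabs (z k l) <= Bz) ->
      exists Cy, 0 < Cy /\ (forall k r, 0 <= r <= 1 -> Rabs (step_fun (nu k) (y k) r) <= Cy) /\
        (forall k r s, 0 <= r <= 1 -> 0 <= s <= 1 ->
           Rabs (step_fun (nu k) (y k) r - step_fun (nu k) (y k) s) <= Cy * Rabs (r - s) + Cy * / (INR k + 1))).
  { intros y z phi L Bz HL HBz Hphi Hrec Hy0 Hz.
    assert (HBL : 0 <= Bz * L) by now apply Rmult_le_pos.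
    assert (Hlip : forall k, forall r s, 0 <= r <= 1 -> 0 <= s <= 1 ->
       Rabs (step_fun (nu k) (y k) r - step_fun (nu k) (y k) s)
         <= Bz * L * Rabs (r - s) + Bz * L * / (INR (nu k) + 1)).
    { intros k. apply step_fun_lipschitz with phi (z k); auto. }
    (* The initial value costs [C], the variation over [[0,1]] and the mesh defect cost [Bz * L]
       each; the [1] makes the constant strictly positive. *)
    exists (C + 2 * (Bz * L) + 1). split; [lra|]. split.
    - intros k r Hr. specialize (Hlip k r 0 Hr ltac:(lra)).
      unfold step_fun in Hlip at 2. rewrite Rmult_0_l in Hlip.
      change 0 with (INR 0) in Hlip at 1. rewrite nfloor_INR in Hlip.
      rewrite Rminus_0_r, (Rabs_right r) in Hlip by lra.
      replace (step_fun (nu k) (y k) r) with ((step_fun (nu k) (y k) r - y k 0%nat) + y k 0%nat) by ring.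
      eapply Rle_trans; [apply Rabs_triang|]. specialize (Hy0 k). specialize (Hone k).
      assert (Bz * L * r <= Bz * L * 1) by (apply Rmult_le_compat_l; lra).
      assert (Bz * L * / (INR (nu k) + 1) <= Bz * L * 1) by (apply Rmult_le_compat_l; lra). lra.
    - intros k r s Hr Hs. eapply Rle_trans; [apply Hlip; assumption|].
      specialize (Hinv k). specialize (Hone k). apply Rplus_le_compat.
      + apply Rmult_le_compat_r; [apply Rabs_pos|lra].
      + apply Rmult_le_compat; lra. }
  destruct (Hasc ew (fun k l => - root N (eJ k l)) (fun t => lam * t) lam (root N B)) as [Cw [Cw0 [Cw1 Cw2]]];
    auto using root_nonneg, lip_increasing_linear, Rlt_le.
  { intros k; apply euler_fst_rec. }
  destruct (Hasc eJ (fun k l => G (ew k l)) (fun t => t ^ N) (INR N) B) as [Cj [Cj0 [Cj1 Cj2]]];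
    auto using lip_increasing_pow.
  { intros k; apply euler_snd_rec. }
  { intros k. cbn. now rewrite Rabs_R0. }
  { intros k l _. specialize (HB (ew k l)). rewrite Rabs_right; lra. }
  destruct (ascoli_asymptotically_lipschitz (fun k => step_fun (nu k) (ew k)) Cw Cw0 Cw1 Cw2)
    as [w [phi1 [Hwc Hw]]].
  (* The second extraction runs along the first subsequence, so both components converge for the
     same indices. *)
  destruct (ascoli_asymptotically_lipschitz (fun k => step_fun (nu (phi1 k)) (eJ (phi1 k))) Cj Cj0)
    as [J [phi2 [HJc HJ']]].
  { intros k r Hr; now apply Cj1. }
  { intros k r s Hr Hs. eapply Rle_trans; [now apply Cj2|]. apply Rplus_le_compat_l.
    apply Rmult_le_compat_l; [lra|]. apply inv_INR_le. apply Hw. }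
  pose (ka := fun k => phi1 (phi2 k)).
  assert (Hka : forall k, (k <= nu (ka k))%nat).
  { intros k. unfold ka. pose proof (proj1 (HJ' k)). pose proof (proj1 (Hw (phi2 k))).
    pose proof (Hnu (phi1 (phi2 k))). lia. }
  assert (Uw' : forall k r, 0 <= r <= 1 -> Rabs (step_fun (nu (ka k)) (ew (ka k)) r - w r) <= / (INR k + 1)).
  { intros k r Hr. eapply Rle_trans; [now apply (proj2 (Hw (phi2 k)))|].
    apply inv_INR_le. apply HJ'. }
  assert (Uw : unif_cv01 (fun k => step_fun (nu (ka k)) (ew (ka k))) w).
  { intros eps He. destruct (inv_INR_small eps He) as [m Hm]. exists m. intros k Hk r Hr.
    eapply Rle_trans; [now apply Uw'|]. now apply Rlt_le, Hm. }
  assert (UJ : unif_cv01 (fun k => step_fun (nu (ka k)) (eJ (ka k))) J).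
  { intros eps He. destruct (inv_INR_small eps He) as [m Hm]. exists m. intros k Hk r Hr.
    eapply Rle_trans; [now apply (proj2 (HJ' k))|]. now apply Rlt_le, Hm. }
  assert (S0 : forall n y, step_fun n y 0 = y 0%nat).
  { intros n y. unfold step_fun. rewrite Rmult_0_l. change 0 with (INR 0). now rewrite nfloor_INR. }
  assert (S1 : forall n y, step_fun n y 1 = y (S n)).
  { intros n y. now rewrite <- (grid_end n), step_fun_grid. }
  exists w, J. split; [split; [exact Hwc|split; [exact HJc|split; [|split]]]|].
  - apply cond_eq. intros eps He. destruct (UJ (eps / 2) ltac:(lra)) as [m Hm].
    specialize (Hm m (le_n m) 0 ltac:(lra)). rewrite S0 in Hm. cbn in Hm.
    rewrite Rabs_minus_sym in Hm. lra.
  - intros r Hr.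
    apply (step_limit_derivative (fun k => nu (ka k)) (fun t => lam * t) (fun x => - root N x) J w lam
             (fun k => eJ (ka k)) (fun k => ew (ka k))); auto using lip_increasing_linear, Rlt_le.
    + apply (continuity_opp _ (continuity_root N HN)).
    + intros k; apply euler_fst_rec.
    + rewrite <- (Rmult_1_r lam) at 1. apply (derivable_pt_lim_scal id). apply derivable_pt_lim_id.
  - intros r Hr.
    apply (step_limit_derivative (fun k => nu (ka k)) (fun t => t ^ N) G w J (INR N)
             (fun k => ew (ka k)) (fun k => eJ (ka k))); auto using lip_increasing_pow.
    + intros k; apply euler_snd_rec.
    + replace (N - 1)%nat with (pred N) by lia. apply derivable_pt_lim_pow.
  - intros eps He. destruct (Uw eps He) as [m Hm]. specialize (Hm m (le_n m)).
    exists (ka m). split.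
    + rewrite Rabs_minus_sym. specialize (Hm 0 ltac:(lra)). now rewrite S0 in Hm.
    + rewrite Rabs_minus_sym. specialize (Hm 1 ltac:(lra)). now rewrite S1 in Hm.
Qed.

(** The sign hypotheses concern exact solutions. They pass to all sufficiently fine polygons: wrong
    signs along arbitrarily fine meshes would yield an exact solution with the wrong sign of
    [w 1]. *)
Lemma shooting (N : nat) (G : R -> R) (B lam a0 a1 : R) :
  (1 <= N)%nat -> continuity G -> (forall s, 0 <= G s <= B) -> 0 < lam -> a0 <= a1 ->
  (forall w J, radial_sol N G lam w J -> w 0 = a0 -> 0 < w 1) ->
  (forall w J, radial_sol N G lam w J -> w 0 = a1 -> w 1 < 0) ->
  exists w J, radial_sol N G lam w J /\ a0 <= w 0 <= a1 /\ w 1 = 0.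
Proof.
  intros HN HG HB Hlam Ha H0 H1.
  (* A property that cannot fail along indices tending to infinity holds eventually. *)
  assert (Hev : forall (P : nat -> Prop),
    (forall nu : nat -> nat, (forall k, (k <= nu k)%nat) -> (forall k, ~ P (nu k)) -> False) ->
    exists m, forall n, (m <= n)%nat -> P n).
  { intros P HP. apply NNPP. intros Hn.
    assert (Hex : forall k, exists n, (k <= n)%nat /\ ~ P n).
    { intros k. apply NNPP. intros Hk. apply Hn. exists k. intros n Hkn. apply NNPP. intros HPn.
      apply Hk. now exists n. }
    apply (HP (fun k => proj1_sig (constructive_indefinite_description _ (Hex k))));
      intros k; apply (proj2_sig (constructive_indefinite_description _ (Hex k))). }
  destruct (Hev (fun n => 0 < euler_end N G lam n a0)) as [m0 Hm0].
  { intros nu Hnu Hneg.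
    destruct (euler_limit N G B lam (Rabs a0) nu (fun _ => a0)) as [w [J [HS HE]]]; auto; [intros; lra|].
    assert (E0 : w 0 = a0).
    { apply cond_eq. intros eps He. destruct (HE (eps / 2) ltac:(lra)) as [k [K1 _]]. lra. }
    specialize (H0 w J HS E0). destruct (HE (w 1 / 2) ltac:(lra)) as [k [_ K2]].
    apply (Hneg k). apply Rabs_le_inv in K2. lra. }
  destruct (Hev (fun n => euler_end N G lam n a1 < 0)) as [m1 Hm1].
  { intros nu Hnu Hneg.
    destruct (euler_limit N G B lam (Rabs a1) nu (fun _ => a1)) as [w [J [HS HE]]]; auto; [intros; lra|].
    assert (E0 : w 0 = a1).
    { apply cond_eq. intros eps He. destruct (HE (eps / 2) ltac:(lra)) as [k [K1 _]]. lra. }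
    specialize (H1 w J HS E0). destruct (HE (- w 1 / 2) ltac:(lra)) as [k [_ K2]].
    apply (Hneg k). apply Rabs_le_inv in K2. lra. }
  assert (Hz : forall k, exists a, a0 <= a <= a1 /\ euler_end N G lam (max k (max m0 m1)) a = 0).
  { intros k. set (n := max k (max m0 m1)).
    destruct (IVT_cor (euler_end N G lam n) a0 a1) as [z [Hz1 Hz2]].
    - apply continuity_euler; assumption.
    - exact Ha.
    - specialize (Hm0 n ltac:(lia)). specialize (Hm1 n ltac:(lia)).
      nra.
    - now exists z. }
  pose (a := fun k => proj1_sig (constructive_indefinite_description _ (Hz k))).
  assert (Haz : forall k, a0 <= a k <= a1 /\ euler_end N G lam (max k (max m0 m1)) (a k) = 0).
  { intros k. apply (proj2_sig (constructive_indefinite_description _ (Hz k))). }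
  destruct (euler_limit N G B lam (Rabs a0 + Rabs a1) (fun k => max k (max m0 m1)) a)
    as [w [J [HS HE]]]; auto; [intros; lia| |].
  { intros k. destruct (Haz k) as [A _].
    unfold Rabs; repeat destruct (Rcase_abs _); lra. }
  exists w, J. split; [exact HS|]. split; [split|].
  - apply le_epsilon. intros eps He. destruct (HE eps He) as [k [K1 _]]. destruct (Haz k) as [A _].
    apply Rabs_le_inv in K1. lra.
  - apply le_epsilon. intros eps He. destruct (HE eps He) as [k [K1 _]]. destruct (Haz k) as [A _].
    apply Rabs_le_inv in K1. lra.
  - apply cond_eq. intros eps He. destruct (HE (eps / 2) ltac:(lra)) as [k [_ K1]].
    destruct (Haz k) as [_ A]. rewrite A in K1. lra.
Qed.

(** * Comparison estimates and the sign of the end value *)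

Lemma derivable_pt_lim_scal_pow (N : nat) (m r : R) :
  derivable_pt_lim (fun t => m * t ^ N) r (m * (INR N * r ^ (N - 1))).
Proof.
  apply (derivable_pt_lim_scal (fun t => t ^ N)).
  replace (N - 1)%nat with (pred N) by lia. apply derivable_pt_lim_pow.
Qed.

Lemma cont_on01_scal_pow (N : nat) (m : R) : cont_on01 (fun t => m * t ^ N).
Proof. apply continuity_cont_on01, (continuity_scal (fun t => t ^ N) m), continuity_pow_nat. Qed.

Lemma cont_on01_opp (F : R -> R) : cont_on01 F -> cont_on01 (fun r => - F r).
Proof.
  intros H. apply cont_on01_ext with (fun r => -1 * F r); [intros; ring|].
  apply cont_on01_mult; [apply cont_on01_const|exact H].
Qed.

Lemma cont_on01_minus (F G : R -> R) :
  cont_on01 F -> cont_on01 G -> cont_on01 (fun r => F r - G r).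
Proof. intros HF HG. apply (cont_on01_plus F (fun r => - G r) HF), cont_on01_opp, HG. Qed.

(** [J] is the integral of [G(w)] against [d(t^N)], so pointwise bounds on [G(w)] integrate to
    multiples of [r^N]. *)
Lemma radial_sol_J_lower (N : nat) (G : R -> R) (lam : R) (w J : R -> R) (m r : R) :
  (1 <= N)%nat -> radial_sol N G lam w J -> 0 <= r <= 1 ->
  (forall t, 0 < t < r -> m <= G (w t)) -> m * r ^ N <= J r.
Proof.
  intros HN (Hw & HJ & HJ0 & Hw' & HJ') Hr Hb.
  assert (E : J 0 - m * 0 ^ N <= J r - m * r ^ N).
  { apply (mono_of_deriv01 (fun t => J t - m * t ^ N)
      (fun t => INR N * t ^ (N - 1) * G (w t) - m * (INR N * t ^ (N - 1)))); try lra.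
    - apply cont_on01_minus; [exact HJ|apply cont_on01_scal_pow].
    - intros t Ht. apply (derivable_pt_lim_minus J (fun t => m * t ^ N));
        [now apply HJ'|apply derivable_pt_lim_scal_pow].
    - intros t Ht. specialize (Hb t Ht).
      replace (_ - _) with ((INR N * t ^ (N - 1)) * (G (w t) - m)) by ring.
      apply Rmult_le_pos; [apply Rmult_le_pos; [apply pos_INR|apply pow_le; lra]|lra]. }
  rewrite pow_i in E by lia. lra.
Qed.

Lemma radial_sol_J_upper (N : nat) (G : R -> R) (lam : R) (w J : R -> R) (M r : R) :
  (1 <= N)%nat -> radial_sol N G lam w J -> 0 <= r <= 1 ->
  (forall t, 0 < t < r -> G (w t) <= M) -> J r <= M * r ^ N.
Proof.
  intros HN (Hw & HJ & HJ0 & Hw' & HJ') Hr Hb.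
  assert (E : M * 0 ^ N - J 0 <= M * r ^ N - J r).
  { apply (mono_of_deriv01 (fun t => M * t ^ N - J t)
      (fun t => M * (INR N * t ^ (N - 1)) - INR N * t ^ (N - 1) * G (w t))); try lra.
    - apply cont_on01_minus; [apply cont_on01_scal_pow|exact HJ].
    - intros t Ht. apply (derivable_pt_lim_minus (fun t => M * t ^ N) J);
        [apply derivable_pt_lim_scal_pow|now apply HJ'].
    - intros t Ht. specialize (Hb t Ht).
      replace (_ - _) with ((INR N * t ^ (N - 1)) * (M - G (w t))) by ring.
      apply Rmult_le_pos; [apply Rmult_le_pos; [apply pos_INR|apply pow_le; lra]|lra]. }
  rewrite pow_i in E by lia. lra.
Qed.

Lemma radial_sol_J_mono (N : nat) (G : R -> R) (lam : R) (w J : R -> R) (p q : R) :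
  (forall s, 0 <= G s) -> radial_sol N G lam w J -> 0 <= p <= q -> q <= 1 -> J p <= J q.
Proof.
  intros HG (Hw & HJ & HJ0 & Hw' & HJ') Hp Hq.
  apply (mono_of_deriv01 J (fun t => INR N * t ^ (N - 1) * G (w t))); try lra; auto.
  intros t Ht. apply Rmult_le_pos; [|apply HG]. apply Rmult_le_pos; [apply pos_INR|apply pow_le; lra].
Qed.

Lemma radial_sol_J_nonneg (N : nat) (G : R -> R) (lam : R) (w J : R -> R) (r : R) :
  (forall s, 0 <= G s) -> radial_sol N G lam w J -> 0 <= r <= 1 -> 0 <= J r.
Proof.
  intros HG HS Hr. destruct HS as (Hw & HJ & HJ0 & HS'). rewrite <- HJ0.
  apply (radial_sol_J_mono N G lam w J); try lra; [exact HG|]. repeat split; tauto.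
Qed.

(** Concavity of [w] in quantitative form: [J] is nondecreasing, so the mean slope lies between the
    slopes at the two ends. *)
Lemma radial_sol_secant (N : nat) (G : R -> R) (lam : R) (w J : R -> R) (p q : R) :
  (1 <= N)%nat -> 0 < lam -> (forall s, 0 <= G s) -> radial_sol N G lam w J ->
  0 <= p <= q -> q <= 1 ->
  lam * root N (J p) * (q - p) <= w p - w q <= lam * root N (J q) * (q - p).
Proof.
  intros HN Hlam HG HS Hp Hq. destruct (Req_dec p q) as [->|Hne]; [lra|].
  pose proof HS as (Hw & HJ & HJ0 & Hw' & HJ').
  destruct (mvt01 w _ p q Hw Hw') as [c [Hc E]]; try lra.
  replace (w p - w q) with (lam * root N (J c) * (q - p)) by lra.
  assert (J p <= J c) by (apply (radial_sol_J_mono N G lam w J); auto; lra).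
  assert (J c <= J q) by (apply (radial_sol_J_mono N G lam w J); auto; lra).
  split; (apply Rmult_le_compat_r; [lra|]); apply Rmult_le_compat_l; try lra; apply root_le; assumption.
Qed.

Lemma radial_sol_decreasing (N : nat) (G : R -> R) (lam : R) (w J : R -> R) (p q : R) :
  (1 <= N)%nat -> 0 < lam -> (forall s, 0 <= G s) -> radial_sol N G lam w J ->
  0 <= p <= q -> q <= 1 -> w q <= w p.
Proof.
  intros HN Hlam HG HS Hp Hq.
  destruct (radial_sol_secant N G lam w J p q) as [H _]; auto.
  assert (0 <= lam * root N (J p) * (q - p)); [|lra].
  apply Rmult_le_pos; [|lra]. apply Rmult_le_pos; [lra|apply root_nonneg].
Qed.

(* If [w 1 >= 0], monotonicity of the slope gives [w (1/2) >= A/2], so superlinearity applies on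
   [0,1/2] and makes the slope on [1/2,1] exceed what is left of [w]. *)
Lemma radial_sol_large_initial_value (N : nat) (g : R -> R) (lam A : R) (w J : R -> R) :
  (1 <= N)%nat -> 0 < lam -> 0 < A -> (forall s, 0 <= s -> 0 <= g s) ->
  (forall s, A / 2 <= s -> (9 / lam) ^ N * s ^ N <= g s) ->
  radial_sol N (fun s => g (clamp 0 A s)) lam w J -> w 0 = A -> w 1 < 0.
Proof.
  intros HN Hlam HA Hg Hsup HS Hw0. apply Rnot_le_lt. intros Hw1.
  set (G := fun s => g (clamp 0 A s)) in *.
  assert (HG : forall s, 0 <= G s) by (intros s; apply Hg, clamp_bounds; lra).
  destruct (radial_sol_secant N G lam w J 0 (1/2)) as [_ S1]; auto; try lra.
  destruct (radial_sol_secant N G lam w J (1/2) 1) as [S2 _]; auto; try lra.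
  assert (Hhalf : A / 2 <= w (1/2)) by lra.
  (* The factors are the superlinear constant [9/lam], the lower bound [A/2] of [w], and the radius
     [1/2]. The slope on [[1/2,1]] is then at least [9A/4] in size, a drop of [9A/8], more than the
     available [A]; any constant above [8] has this effect. *)
  assert (HJ : (9 * A / (4 * lam)) ^ N <= J (1/2)).
  { replace (9 * A / (4 * lam)) with ((9 / lam) * (A / 2) * (1/2)) by (field; lra).
    rewrite !Rpow_mult_distr. apply (radial_sol_J_lower N G lam w J); auto; [lra|].
    intros t Ht.
    assert (w (1/2) <= w t) by (apply (radial_sol_decreasing N G lam w J); auto; lra).
    assert (w t <= w 0) by (apply (radial_sol_decreasing N G lam w J); auto; lra).
    unfold G. rewrite clamp_id by lra. eapply Rle_trans; [|apply Hsup; lra].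
    apply Rmult_le_compat_l; [apply pow_le; apply Rlt_le, Rdiv_lt_0_compat; lra|].
    apply pow_incr; lra. }
  assert (Hroot : 9 * A / (4 * lam) <= root N (J (1/2))).
  { apply pow_le_inv with N; [exact HN|apply root_nonneg|].
    rewrite root_pow; auto. apply (radial_sol_J_nonneg N G lam w J); auto; lra. }
  apply Rmult_le_compat_l with (r := lam) in Hroot; [|lra].
  replace (lam * (9 * A / (4 * lam))) with (9 * A / 4) in Hroot by (field; lra).
  assert (w (1/2) <= w 0) by (apply (radial_sol_decreasing N G lam w J); auto; lra).
  lra.
Qed.

(** For even [N] the equation does not determine the sign of [v']. Strict growth of [(-v')^N] from
    [0] only gives [v' <> 0] on [(0,1]]; the sign is then constant by intermediate values, and
    negative because [v] falls from [v(1/2) > 0] to [0]. The linear lower bound plays the role of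
    Hopf's boundary lemma: it lets a multiple of [v] dominate any Lipschitz function vanishing at or
    before [1]. *)
Lemma pos_eigenfunction_shape (N : nat) (lam1 : R) :
  (1 <= N)%nat -> 0 < lam1 -> has_pos_eigenfunction N lam1 ->
  exists (v v1 : R -> R) (m : R), 0 < m /\ cont_on01 v /\ cont_on01 v1 /\
    (forall r, 0 < r < 1 -> derivable_pt_lim v r (v1 r)) /\
    (forall r, 0 < r < 1 ->
       derivable_pt_lim (fun s => (- v1 s) ^ N) r (lam1 ^ N * INR N * r ^ (N - 1) * v r ^ N)) /\
    v1 0 = 0 /\ (forall r, 0 <= r <= 1 -> v1 r <= 0) /\
    (forall r, 0 <= r <= 1 -> m * (1 - r) <= v r).
Proof.
  intros HN Hlam1 (v & v1 & v2 & Hv & Hv1 & Hv2 & HP & Hv10 & Hv1' & Hpos).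
  assert (Hvc := deriv_on01_cont _ _ Hv). assert (Hv1c := deriv_on01_cont _ _ Hv1).
  assert (Hvd : forall r, 0 < r < 1 -> derivable_pt_lim v r (v1 r))
    by (intros r Hr; now apply deriv_on01_interior).
  assert (HPc : cont_on01 (fun s => (- v1 s) ^ N)).
  { apply (cont_on01_comp (fun x => x ^ N) (fun s => - v1 s)); [apply continuity_pow_nat|now apply cont_on01_opp]. }
  assert (HPinc : forall p q, 0 <= p < q -> q <= 1 -> (- v1 p) ^ N < (- v1 q) ^ N).
  { intros p q Hp Hq. destruct (mvt01 _ _ p q HPc HP) as [c [Hc E]]; try lra.
    assert (0 < lam1 ^ N * INR N * c ^ (N - 1) * v c ^ N * (q - p)); [|lra].
    repeat apply Rmult_lt_0_compat; try apply pow_lt; try apply Hpos; try lra.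
    apply lt_0_INR; lia. }
  assert (Hne : forall r, 0 < r <= 1 -> v1 r <> 0).
  { intros r Hr E. specialize (HPinc 0 r ltac:(lra) ltac:(lra)).
    rewrite E, Hv10 in HPinc. lra. }
  destruct (mvt01 v v1 (1/2) 1 Hvc Hvd) as [c [Hc Ec]]; try lra.
  assert (Hvc0 : v1 c < 0) by (specialize (Hpos (1/2) ltac:(lra)); lra).
  assert (Hneg : forall r, 0 < r <= 1 -> v1 r < 0).
  { intros r Hr. apply Rnot_le_lt. intros Hge. specialize (Hne r Hr) as Hr0.
    assert (Hz : exists z, 0 < z <= 1 /\ v1 z = 0).
    { destruct (Rle_or_lt r c).
      - destruct (IVT_cor (fun x => v1 (clamp 0 1 x)) r c) as [z [Z1 Z2]].
        + now apply cont_on01_clamp.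
        + lra.
        + rewrite !clamp_id by lra. nra.
        + exists z. rewrite clamp_id in Z2 by lra. split; [lra|exact Z2].
      - destruct (IVT_cor (fun x => v1 (clamp 0 1 x)) c r) as [z [Z1 Z2]].
        + now apply cont_on01_clamp.
        + lra.
        + rewrite !clamp_id by lra. nra.
        + exists z. rewrite clamp_id in Z2 by lra. split; [lra|exact Z2]. }
    destruct Hz as [z [Z1 Z2]]. now apply (Hne z). }
  assert (Hle : forall r, 0 <= r <= 1 -> v1 r <= 0).
  { intros r Hr. destruct (Req_dec r 0) as [->|]; [lra|]. apply Rlt_le, Hneg; lra. }
  assert (Hup : forall r, 1/2 <= r <= 1 -> - v1 (1/2) * (1 - r) <= v r).
  { intros r Hr. destruct (Req_dec r 1) as [->|Hr1]; [lra|].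
    destruct (mvt01 v v1 r 1 Hvc Hvd) as [x [Hx Ex]]; try lra.
    assert (- v1 (1/2) <= - v1 x).
    { apply pow_le_inv with N; [exact HN|specialize (Hle x ltac:(lra)); lra|].
      apply Rlt_le, HPinc; lra. }
    assert (- v1 (1/2) * (1 - r) <= - v1 x * (1 - r)) by (apply Rmult_le_compat_r; lra). lra. }
  (* On [[1/2,1]] the slope gives twice this constant. The half is needed on [[0,1/2]], where only
     [v >= v(1/2)] is used. *)
  exists v, v1, (- v1 (1/2) / 2). specialize (Hneg (1/2) ltac:(lra)) as Hm.
  repeat split; auto; [lra|].
  intros r Hr. destruct (Rle_or_lt (1/2) r) as [Hr2|Hr2].
  - eapply Rle_trans; [|apply Hup; lra]. apply Rmult_le_compat_r; lra.
  - specialize (Hup (1/2) ltac:(lra)).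
    assert (- v r <= - v (1/2)).
    { apply (mono_of_deriv01 (fun t => - v t) (fun t => - v1 t)); try lra.
      - now apply cont_on01_opp.
      - intros t Ht. apply (derivable_pt_lim_opp v). now apply Hvd.
      - intros t Ht. specialize (Hle t ltac:(lra)). lra. }
    assert (- v1 (1/2) / 2 * (1 - r) <= - v1 (1/2) / 2 * 1) by (apply Rmult_le_compat_l; lra).
    lra.
Qed.

(* A solution vanishing at [r0 <= 1] would satisfy [w <= c v] for some [c], where [v] is the
   eigenfunction; integrating the equation twice improves this to [w <= (mu / lam1) c v], and
   iterating forces [w <= 0]. *)
Lemma radial_sol_small_initial_value (N : nat) (g : R -> R) (lam lam1 mu A d : R) (w J : R -> R) :
  (1 <= N)%nat -> 0 < lam -> 0 < lam1 -> has_pos_eigenfunction N lam1 -> 0 <= mu < lam1 ->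
  0 < d <= A -> (forall s, 0 <= s -> 0 <= g s) ->
  (forall s, 0 <= s <= d -> lam ^ N * g s <= mu ^ N * s ^ N) ->
  radial_sol N (fun s => g (clamp 0 A s)) lam w J -> w 0 = d -> 0 < w 1.
Proof.
  intros HN Hlam Hlam1 Heig Hmu Hd Hg Hsub HS Hw0. apply Rnot_le_lt. intros Hw1.
  set (G := fun s => g (clamp 0 A s)) in *.
  assert (HG : forall s, 0 <= G s) by (intros s; apply Hg, clamp_bounds; lra).
  destruct (pos_eigenfunction_shape N lam1 HN Hlam1 Heig)
    as (v & v1 & m & Hm & Hv & Hv1 & Hvd & HP & Hv10 & Hv1n & Hvm).
  pose proof HS as (Hwc & HJc & HJ0 & Hw' & HJ').
  destruct (IVT_cor (fun x => w (clamp 0 1 x)) 0 1) as [r0 [Hr0 Hwr0]].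
  { now apply cont_on01_clamp. }
  { lra. }
  { rewrite !clamp_id by lra. nra. }
  rewrite clamp_id in Hwr0 by lra.
  assert (Hwb : forall t, 0 <= t <= r0 -> 0 <= w t <= d).
  { intros t Ht. rewrite <- Hwr0, <- Hw0.
    split; apply (radial_sol_decreasing N G lam w J); auto; lra. }
  set (ka := mu / lam1).
  assert (Hka : 0 <= ka < 1).
  { unfold ka. split.
    - apply Rmult_le_pos; [lra|]. apply Rlt_le, Rinv_0_lt_compat; lra.
    - apply Rmult_lt_reg_r with lam1; [lra|]. unfold Rdiv. rewrite Rmult_assoc, Rinv_l; lra. }
  assert (Hv0 : forall t, 0 <= t <= 1 -> 0 <= v t).
  { intros t Ht. specialize (Hvm t Ht). assert (0 <= m * (1 - t)) by (apply Rmult_le_pos; lra). lra. }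
  assert (Hstep : forall c, 0 <= c -> (forall t, 0 <= t <= r0 -> w t <= c * v t) ->
                    forall t, 0 <= t <= r0 -> w t <= ka * c * v t).
  { intros c Hc Hcv.
    assert (Hkc : 0 <= ka * c) by (apply Rmult_le_pos; lra).
    (* First integration: [lam^N G(w) <= (mu w)^N <= (mu c v)^N], and the last term equals
       [(ka c)^N lam1^N v^N] because [ka lam1 = mu]. *)
    assert (HJP : forall t, 0 <= t <= r0 -> lam ^ N * J t <= (ka * c) ^ N * (- v1 t) ^ N).
    { intros t Ht.
      assert (E : (ka * c) ^ N * (- v1 0) ^ N - lam ^ N * J 0 <= (ka * c) ^ N * (- v1 t) ^ N - lam ^ N * J t).
      { apply (mono_of_deriv01 (fun t => (ka * c) ^ N * (- v1 t) ^ N - lam ^ N * J t)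
          (fun t => (ka * c) ^ N * (lam1 ^ N * INR N * t ^ (N - 1) * v t ^ N)
                    - lam ^ N * (INR N * t ^ (N - 1) * G (w t)))); try lra.
        - apply cont_on01_minus; apply cont_on01_mult; try apply cont_on01_const; [|exact HJc].
          apply (cont_on01_comp (fun x => x ^ N) (fun s => - v1 s)); [apply continuity_pow_nat|now apply cont_on01_opp].
        - intros s Hs. apply (derivable_pt_lim_minus (fun t => (ka * c) ^ N * (- v1 t) ^ N) (fun t => lam ^ N * J t)).
          + apply (derivable_pt_lim_scal (fun t => (- v1 t) ^ N)). now apply HP.
          + apply (derivable_pt_lim_scal J). now apply HJ'.
        - intros s Hs. specialize (Hwb s ltac:(lra)).
          replace ((ka * c) ^ N * (lam1 ^ N * INR N * s ^ (N - 1) * v s ^ N)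
                   - lam ^ N * (INR N * s ^ (N - 1) * G (w s)))
            with (INR N * s ^ (N - 1) * ((ka * c * lam1 * v s) ^ N - lam ^ N * G (w s)))
            by (rewrite !Rpow_mult_distr; ring).
          apply Rmult_le_pos; [apply Rmult_le_pos; [apply pos_INR|apply pow_le; lra]|].
          unfold G. rewrite clamp_id by lra. specialize (Hsub (w s) Hwb).
          assert ((mu * w s) ^ N <= (ka * c * lam1 * v s) ^ N).
          { apply pow_incr. split; [apply Rmult_le_pos; lra|].
            replace (ka * c * lam1 * v s) with (mu * (c * v s)) by (unfold ka; field; lra).
            apply Rmult_le_compat_l; [lra|]. apply Hcv; lra. }
          rewrite Rpow_mult_distr in H. lra. }
      rewrite Hv10, HJ0, Ropp_0, pow_i in E by lia. lra. }
    intros t Ht.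
    (* The second integration starts from [r0], where [w] vanishes and [v] is nonnegative. *)
    assert (E : - (ka * c * v t - w t) <= - (ka * c * v r0 - w r0)).
    { apply (mono_of_deriv01 (fun t => - (ka * c * v t - w t))
        (fun t => - (ka * c * v1 t - lam * - root N (J t)))); try lra.
      - apply cont_on01_opp, cont_on01_minus; [|exact Hwc].
        apply cont_on01_mult; [apply cont_on01_const|exact Hv].
      - intros s Hs. apply (derivable_pt_lim_opp (fun t => ka * c * v t - w t)).
        apply (derivable_pt_lim_minus (fun t => ka * c * v t) w); [|now apply Hw'].
        apply (derivable_pt_lim_scal v). now apply Hvd.
      - intros s Hs.
        assert (lam * root N (J s) <= ka * c * - v1 s); [|lra].
        apply pow_le_inv with N; [exact HN| |].
        + apply Rmult_le_pos; [lra|]. specialize (Hv1n s ltac:(lra)). lra.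
        + rewrite Rpow_mult_distr, root_pow, (Rpow_mult_distr (ka * c)); auto.
          * apply HJP; lra.
          * apply (radial_sol_J_nonneg N G lam w J); auto; lra. }
    assert (0 <= ka * c * v r0) by (apply Rmult_le_pos; [lra|apply Hv0; lra]). lra. }
  (* [Lw] bounds the slope of [w] on [[0,r0]], hence [w t <= Lw (1 - t) <= (Lw / m) v t], which
     starts the iteration. *)
  set (Lw := lam * root N (J r0)).
  assert (HLw : 0 <= Lw) by (apply Rmult_le_pos; [lra|apply root_nonneg]).
  set (c0 := Lw / m).
  assert (Hc0 : 0 <= c0) by (apply Rmult_le_pos; [lra|]; apply Rlt_le, Rinv_0_lt_compat; lra).
  assert (Hit : forall k t, 0 <= t <= r0 -> w t <= ka ^ k * c0 * v t).
  { induction k as [|k IH].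
    - intros t Ht. rewrite pow_O, Rmult_1_l.
      destruct (radial_sol_secant N G lam w J t r0) as [_ S]; auto; try lra. fold Lw in S.
      assert (Lw * (r0 - t) <= Lw * (1 - t)) by (apply Rmult_le_compat_l; lra).
      assert (c0 * (m * (1 - t)) <= c0 * v t) by (apply Rmult_le_compat_l; [lra|apply Hvm; lra]).
      replace (c0 * (m * (1 - t))) with (Lw * (1 - t)) in H0 by (unfold c0; field; lra). lra.
    - intros t Ht. simpl. rewrite (Rmult_assoc ka). apply Hstep; auto.
      apply Rmult_le_pos; [apply pow_le; lra|exact Hc0]. }
  assert (Hcv : 0 <= c0 * v 0) by (apply Rmult_le_pos; [lra|apply Hv0; lra]).
  (* The added [1] keeps the denominator positive even if [c0 * v 0 = 0]. For this [k] the iterated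
     bound at [0] gives [w 0 < d], contradicting [w 0 = d]. *)
  destruct (pow_lt_1_zero ka ltac:(rewrite Rabs_right; lra) (d / (c0 * v 0 + 1))) as [k Hk].
  { apply Rdiv_lt_0_compat; lra. }
  specialize (Hk k (le_n k)). specialize (Hit k 0 ltac:(lra)).
  apply Rabs_def2 in Hk. destruct Hk as [Hk _].
  apply Rmult_lt_compat_r with (r := c0 * v 0 + 1) in Hk; [|lra].
  replace (d / (c0 * v 0 + 1) * (c0 * v 0 + 1)) with d in Hk by (field; lra).
  assert (0 <= ka ^ k) by (apply pow_le; lra). lra.
Qed.

(** * Regularity, concavity and positivity of radial solutions *)

Lemma strictly_concave_of_deriv (w w1 : R -> R) :
  cont_on01 w -> (forall r, 0 < r < 1 -> derivable_pt_lim w r (w1 r)) ->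
  (forall r s, 0 < r -> r < s -> s < 1 -> w1 s < w1 r) -> strictly_concave_01 w.
Proof.
  intros Hw Hd Hdec.
  assert (Hlt : forall x y t, 0 < x -> x < y -> y < 1 -> 0 < t < 1 ->
            t * w x + (1 - t) * w y < w (t * x + (1 - t) * y)).
  { intros x y t Hx Hxy Hy Ht. set (z := t * x + (1 - t) * y).
    assert (Hz1 : z - x = (1 - t) * (y - x)) by (unfold z; ring).
    assert (Hz2 : y - z = t * (y - x)) by (unfold z; ring).
    assert (0 < (1 - t) * (y - x)) by (apply Rmult_lt_0_compat; lra).
    assert (0 < t * (y - x)) by (apply Rmult_lt_0_compat; lra).
    destruct (mvt01 w w1 x z Hw Hd) as [c1 [C1 E1]]; try lra.
    destruct (mvt01 w w1 z y Hw Hd) as [c2 [C2 E2]]; try lra.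
    rewrite Hz1 in E1. rewrite Hz2 in E2.
    specialize (Hdec c1 c2 ltac:(lra) ltac:(lra) ltac:(lra)).
    assert (0 < t * ((1 - t) * (y - x)) * (w1 c1 - w1 c2)).
    { apply Rmult_lt_0_compat; [|lra]. apply Rmult_lt_0_compat; lra. }
    assert (w z - (t * w x + (1 - t) * w y) = t * (w z - w x) - (1 - t) * (w y - w z)) by ring.
    rewrite E1, E2 in H2. lra. }
  intros x y t Hx Hy Hne Ht. destruct (Rtotal_order x y) as [H|[H|H]]; [|contradiction|].
  - apply Hlt; lra.
  - specialize (Hlt y x (1 - t) ltac:(lra) H ltac:(lra) ltac:(lra)).
    replace (1 - (1 - t)) with t in Hlt by ring.
    replace (t * x + (1 - t) * y) with ((1 - t) * y + t * x) by ring. lra.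
Qed.

Lemma radial_sol_J_strict_mono (N : nat) (G : R -> R) (lam : R) (w J : R -> R) (p q : R) :
  (1 <= N)%nat -> radial_sol N G lam w J -> (forall r, 0 <= r < 1 -> 0 < G (w r)) ->
  0 <= p < q -> q <= 1 -> J p < J q.
Proof.
  intros HN (Hw & HJ & HJ0 & Hw' & HJ') HG Hp Hq.
  destruct (mvt01 J _ p q HJ HJ') as [c [Hc E]]; try lra.
  assert (0 < INR N * c ^ (N - 1) * G (w c) * (q - p)); [|lra].
  repeat apply Rmult_lt_0_compat; [apply lt_0_INR; lia|apply pow_lt; lra|apply HG; lra|lra].
Qed.

(* [J / r^N], extended continuously to [r = 0]. *)
Definition radial_mean (N : nat) (G w J : R -> R) (r : R) : R :=
  if Req_EM_T r 0 then G (w 0) else J r / r ^ N.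

(** The quotient is the mean of [G(w)] over [[0,r]] with respect to [d(t^N)], and so tends to
    [G(w 0)]. *)
Lemma cont_on01_radial_mean (N : nat) (G : R -> R) (lam : R) (w J : R -> R) :
  (1 <= N)%nat -> continuity G -> radial_sol N G lam w J -> cont_on01 (radial_mean N G w J).
Proof.
  intros HN HGc HS. pose proof HS as (Hw & HJ & HJ0 & Hw' & HJ').
  intros r Hr eps He. destruct (Req_dec r 0) as [->|Hr0].
  - destruct (cont_on01_comp G w HGc Hw 0 ltac:(lra) (eps / 2) ltac:(lra)) as [d [Hd H]].
    exists d; split; [exact Hd|]. intros s Hs Hsd. unfold radial_mean at 2.
    destruct (Req_EM_T 0 0) as [_|]; [|lra].
    unfold radial_mean. destruct (Req_EM_T s 0) as [_|Hs0]; [rewrite Rminus_diag, Rabs_R0; lra|].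
    rewrite Rminus_0_r, Rabs_right in Hsd by lra.
    assert (Hnear : forall t, 0 < t < s -> G (w 0) - eps / 2 <= G (w t) <= G (w 0) + eps / 2).
    { intros t Ht. specialize (H t ltac:(lra)). rewrite Rminus_0_r, Rabs_right in H by lra.
      specialize (H ltac:(lra)). apply Rabs_def2 in H. lra. }
    assert (L := radial_sol_J_lower N G lam w J _ s HN HS Hs (fun t Ht => proj1 (Hnear t Ht))).
    assert (U := radial_sol_J_upper N G lam w J _ s HN HS Hs (fun t Ht => proj2 (Hnear t Ht))).
    assert (Hsp : 0 < s ^ N) by (apply pow_lt; lra).
    apply Rle_lt_trans with (eps / 2); [|lra].
    replace (J s / s ^ N - G (w 0)) with ((J s - G (w 0) * s ^ N) / s ^ N) by (field; lra).
    unfold Rdiv at 1. rewrite Rabs_mult, Rabs_inv, (Rabs_right (s ^ N)) by lra.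
    apply Rmult_le_reg_r with (s ^ N); [exact Hsp|]. rewrite Rmult_assoc, Rinv_l by lra.
    rewrite Rmult_1_r. apply Rabs_le. lra.
  (* Clamping the denominator at [r/2] leaves the quotient unchanged near [r] and removes the zero
     at the origin. *)
  - assert (HK : cont_on01 (fun s => J s * / clamp (r / 2) 1 s ^ N)).
    { apply cont_on01_mult; [exact HJ|]. apply cont_on01_inv.
      - apply (cont_on01_comp (fun x => x ^ N)); [apply continuity_pow_nat|].
        apply continuity_cont_on01, continuity_clamp.
      - intros s _. apply pow_nonzero. pose proof (clamp_bounds (r / 2) 1 s ltac:(lra)). lra. }
    destruct (HK r Hr eps He) as [d [Hd H]]. exists (Rmin d (r / 2)). split; [apply Rmin_pos; lra|].
    intros s Hs Hsd.
    assert (D1 := Rlt_le_trans _ _ _ Hsd (Rmin_l _ _)).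
    assert (D2 := Rlt_le_trans _ _ _ Hsd (Rmin_r _ _)). apply Rabs_def2 in D2.
    specialize (H s Hs D1). rewrite !clamp_id in H by lra.
    unfold radial_mean. destruct (Req_EM_T s 0); [lra|]. destruct (Req_EM_T r 0); [lra|]. exact H.
Qed.

(** The chain rule gives [w'' = - lam r^(N-1) G(w) / root(J)^(N-1)], of the form [0/0] at the origin
    if [N >= 2]. Writing [root(J) = r D], with [D] the root of the mean, cancels [r^(N-1)]; [D] is
    continuous, and positive also at [0] since [G(w 0) > 0]. *)
Lemma radial_sol_C2 (N : nat) (G : R -> R) (lam : R) (w J : R -> R) :
  (1 <= N)%nat -> 0 < lam -> continuity G ->
  radial_sol N G lam w J -> (forall r, 0 <= r < 1 -> 0 < G (w r)) ->
  exists w1 w2, deriv_on01 w w1 /\ deriv_on01 w1 w2 /\ cont_on01 w2 /\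
    (forall r, 0 < r < 1 ->
       derivable_pt_lim (fun s => (- w1 s) ^ N) r (lam ^ N * INR N * r ^ (N - 1) * G (w r))) /\
    w1 0 = 0 /\ strictly_concave_01 w.
Proof.
  intros HN Hlam HGc HS HGpos. pose proof HS as (Hw & HJ & HJ0 & Hw' & HJ').
  assert (HJpos : forall r, 0 < r <= 1 -> 0 < J r).
  { intros r Hr. rewrite <- HJ0. apply (radial_sol_J_strict_mono N G lam w J); auto; lra. }
  pose (D := fun r => root N (radial_mean N G w J r)).
  assert (HDc : cont_on01 D).
  { apply (cont_on01_comp (root N)); [now apply continuity_root|].
    now apply cont_on01_radial_mean with lam. }
  assert (HDpos : forall r, 0 <= r <= 1 -> 0 < D r).
  { intros r Hr. apply root_pos. unfold radial_mean. destruct (Req_EM_T r 0) as [->|Hr0].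
    - apply HGpos; lra.
    - apply Rdiv_lt_0_compat; [apply HJpos; lra|apply pow_lt; lra]. }
  assert (HDroot : forall r, 0 < r <= 1 -> root N (J r) = r * D r).
  { intros r Hr. apply root_unique; [exact HN|apply Rmult_le_pos; [lra|apply Rlt_le, HDpos; lra]|].
    unfold D, radial_mean. destruct (Req_EM_T r 0); [lra|].
    assert (0 < r ^ N) by (apply pow_lt; lra).
    rewrite Rpow_mult_distr, root_pow; [field; lra|exact HN|].
    apply Rlt_le, Rdiv_lt_0_compat; [apply HJpos|]; lra. }
  assert (Hrc : cont_on01 (fun r => root N (J r))) by (apply cont_on01_comp; [now apply continuity_root|exact HJ]).
  assert (Hw1c : cont_on01 (fun r => lam * - root N (J r))).
  { apply cont_on01_mult; [apply cont_on01_const|]. now apply cont_on01_opp. }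
  assert (Hw2c : cont_on01 (fun r => lam * - (G (w r) * / D r ^ (N - 1)))).
  { apply cont_on01_mult; [apply cont_on01_const|]. apply cont_on01_opp, cont_on01_mult.
    - now apply cont_on01_comp.
    - apply cont_on01_inv.
      + apply (cont_on01_comp (fun x => x ^ (N - 1))); [apply continuity_pow_nat|exact HDc].
      + intros r Hr. apply pow_nonzero. specialize (HDpos r Hr). lra. }
  exists (fun r => lam * - root N (J r)), (fun r => lam * - (G (w r) * / D r ^ (N - 1))).
  split; [now apply deriv_on01_of_interior|].
  split; [apply deriv_on01_of_interior; auto|split; [exact Hw2c|split; [|split]]].
  - intros r Hr. apply (derivable_pt_lim_scal (fun r => - root N (J r))).
    apply (derivable_pt_lim_opp (fun r => root N (J r))).
    specialize (HDpos r ltac:(lra)).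
    assert (0 < INR N) by (apply lt_0_INR; lia).
    assert (0 < D r ^ (N - 1)) by now apply pow_lt.
    assert (0 < r ^ (N - 1)) by (apply pow_lt; lra).
    replace (G (w r) * / D r ^ (N - 1)) with
      (/ (INR N * root N (J r) ^ (N - 1)) * (INR N * r ^ (N - 1) * G (w r))).
    + apply (derivable_pt_lim_comp J (root N)); [now apply HJ'|].
      apply derivable_pt_lim_root; [exact HN|apply HJpos; lra].
    + rewrite HDroot, Rpow_mult_distr by lra. field; lra.
  - intros r Hr. replace (lam ^ N * INR N * r ^ (N - 1) * G (w r)) with
      (lam ^ N * (INR N * r ^ (N - 1) * G (w r))) by ring.
    apply derivable_pt_lim_local01 with (fun s => lam ^ N * J s); [exact Hr| |].
    + intros y Hy. replace (- (lam * - root N (J y))) with (lam * root N (J y)) by ring.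
      rewrite Rpow_mult_distr, root_pow; [reflexivity|exact HN|]. apply Rlt_le, HJpos; lra.
    + apply (derivable_pt_lim_scal J). now apply HJ'.
  - rewrite HJ0, root_0. ring.
  - apply strictly_concave_of_deriv with (fun r => lam * - root N (J r)); auto.
    intros r s Hr Hrs Hs. apply Rmult_lt_compat_l; [exact Hlam|]. apply Ropp_lt_contravar.
    apply root_lt; [exact HN|apply Rlt_le, HJpos; lra|].
    apply (radial_sol_J_strict_mono N G lam w J); auto; lra.
Qed.

(** If [J r = 0] with [r > 0], then [J] vanishes on [[0,r]] and [w] keeps its initial value there,
    where [G] is positive, so [J] would have grown. Thus the slope is negative for [r > 0], and [w]
    reaches [0] only at [1]. *)
Lemma radial_sol_pos (N : nat) (G : R -> R) (lam A : R) (w J : R -> R) :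
  (1 <= N)%nat -> 0 < lam -> (forall s, 0 <= G s) -> (forall s, 0 < s <= A -> 0 < G s) ->
  radial_sol N G lam w J -> 0 < w 0 <= A -> w 1 = 0 -> forall r, 0 <= r < 1 -> 0 < w r.
Proof.
  intros HN Hlam HG HGpos HS Hw0 Hw1.
  pose proof HS as (Hw & HJ & HJ0 & Hw' & HJ').
  assert (HJpos : forall r, 0 < r <= 1 -> 0 < J r).
  { intros r Hr. apply Rnot_le_lt. intros HJr.
    destruct (mvt01 J _ 0 r HJ HJ') as [c [Hc E]]; try lra.
    destruct (radial_sol_secant N G lam w J 0 c) as [_ S]; auto; try lra.
    assert (J c <= J r) by (apply (radial_sol_J_mono N G lam w J); auto; lra).
    assert (J c = 0).
    { apply Rle_antisym; [lra|]. apply (radial_sol_J_nonneg N G lam w J); auto; lra. }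
    rewrite H0, root_0 in S.
    assert (w c <= w 0) by (apply (radial_sol_decreasing N G lam w J); auto; lra).
    assert (0 < INR N * c ^ (N - 1) * G (w c) * (r - 0)); [|lra].
    repeat apply Rmult_lt_0_compat; [apply lt_0_INR; lia|apply pow_lt; lra|apply HGpos; lra|lra]. }
  intros r Hr. destruct (Req_dec r 0) as [->|Hr0]; [lra|].
  destruct (radial_sol_secant N G lam w J r 1) as [S _]; auto; try lra.
  assert (0 < lam * root N (J r) * (1 - r)); [|lra].
  apply Rmult_lt_0_compat; [|lra]. apply Rmult_lt_0_compat; [lra|]. apply root_pos, HJpos; lra.
Qed.

(** * Existence for a one-sided nonlinearity, and reflection *)

Lemma continuity_bounded_above (g : R -> R) (A : R) :
  continuity g -> 0 <= A -> exists B, forall s, 0 <= s <= A -> g s <= B.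
Proof.
  intros Hg HA. destruct (continuity_ab_maj g 0 A HA) as [M [HM _]]; [intros c _; apply Hg|].
  exists (g M). exact HM.
Qed.

(** Apart from continuity, the conditions on [g] concern positive arguments only, so that [f] and
    its reflection both qualify. *)
Lemma positive_radial_solution (N : nat) (g : R -> R) (f0 lam1 lam : R) :
  (1 <= N)%nat -> continuity g -> (forall s, 0 < s -> 0 < g s) -> 0 < f0 ->
  (forall eps, 0 < eps -> exists delta, 0 < delta /\
     forall s, 0 < s < delta -> Rabs (g s / s ^ N - f0 ^ N) < eps) ->
  (forall M, exists K, forall s, 0 < s -> K < s -> M < g s / s ^ N) ->
  0 < lam1 -> has_pos_eigenfunction N lam1 -> 0 < lam < lam1 / f0 ->
  exists w w1 w2, deriv_on01 w w1 /\ deriv_on01 w1 w2 /\ cont_on01 w2 /\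
    (forall r, 0 < r < 1 ->
       derivable_pt_lim (fun s => (- w1 s) ^ N) r (lam ^ N * INR N * r ^ (N - 1) * g (w r))) /\
    w1 0 = 0 /\ w 1 = 0 /\ (forall r, 0 < r < 1 -> 0 < w r) /\ strictly_concave_01 w.
Proof.
  intros HN Hgc Hgpos Hf0 Hzero Hinf Hlam1 Heig Hlam.
  assert (Hll : lam * f0 < lam1).
  { destruct Hlam as [_ Hlam]. apply Rmult_lt_compat_r with (r := f0) in Hlam; [|exact Hf0].
    replace (lam1 / f0 * f0) with lam1 in Hlam by (field; lra). exact Hlam. }
  assert (Hlf : 0 < lam * f0) by (apply Rmult_lt_0_compat; lra).
  (* The midpoint lies above [lam f0], which gives [lam^N g(s) <= mu^N s^N] near [0], and below
     [lam1], as the comparison requires. *)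
  set (mu := (lam * f0 + lam1) / 2).
  assert (Hmu : f0 < mu / lam).
  { apply Rmult_lt_reg_r with lam; [lra|]. replace (mu / lam * lam) with mu by (field; lra).
    unfold mu; lra. }
  destruct (Hzero ((mu / lam) ^ N - f0 ^ N)) as [d0 [Hd0 Hsub0]].
  { assert (f0 ^ N < (mu / lam) ^ N); [|lra].
    apply Rnot_le_lt. intros H. apply pow_le_inv in H; [lra|exact HN|lra]. }
  assert (Hsub1 : forall s, 0 < s < d0 -> g s <= (mu / lam) ^ N * s ^ N).
  { intros s Hs. specialize (Hsub0 s Hs). apply Rabs_def2 in Hsub0.
    assert (0 < s ^ N) by (apply pow_lt; lra).
    apply Rmult_le_reg_r with (/ s ^ N); [now apply Rinv_0_lt_compat|].
    rewrite Rmult_assoc, Rinv_r by lra. unfold Rdiv in Hsub0 at 1. lra. }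
  (* The positivity hypothesis is silent at [0]. The value follows by continuity from
     [0 < g s <= (mu/lam)^N s^N], and it is the value of the truncation at all negative
     arguments. *)
  assert (Hg0 : g 0 = 0).
  { apply cond_eq. intros eps He.
    destruct (proj1 (continuity_pt_eps g 0) (Hgc 0) (eps / 2) ltac:(lra)) as [d1 [Hd1 Hg1]].
    destruct (proj1 (continuity_pt_eps _ 0)
      (continuity_scal _ ((mu / lam) ^ N) (continuity_pow_nat N) 0) (eps / 2) ltac:(lra)) as [d2 [Hd2 Hg2]].
    set (s := Rmin d0 (Rmin d1 d2) / 2).
    assert (Hs : 0 < s < d0 /\ s < d1 /\ s < d2).
    { assert (0 < Rmin d0 (Rmin d1 d2)) by (repeat apply Rmin_pos; assumption).
      pose proof (Rmin_l d0 (Rmin d1 d2)). pose proof (Rmin_r d0 (Rmin d1 d2)).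
      pose proof (Rmin_l d1 d2). pose proof (Rmin_r d1 d2). unfold s. lra. }
    specialize (Hg1 s ltac:(rewrite Rminus_0_r, Rabs_right; lra)).
    specialize (Hg2 s ltac:(rewrite Rminus_0_r, Rabs_right; lra)).
    unfold mult_real_fct in Hg2. rewrite pow_i in Hg2 by lia.
    specialize (Hsub1 s ltac:(lra)). specialize (Hgpos s ltac:(lra)).
    apply Rabs_def2 in Hg1. apply Rabs_def2 in Hg2. apply Rabs_def1; lra. }
  assert (Hgnn : forall s, 0 <= s -> 0 <= g s).
  { intros s Hs. destruct (Req_dec s 0) as [->|]; [lra|]. apply Rlt_le, Hgpos; lra. }
  destruct (Hinf ((9 / lam) ^ N)) as [K HK].
  (* Chosen so that [A/2 > K]: superlinearity then holds for every [s >= A/2]. *)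
  set (A := 2 * (Rabs K + 1)).
  set (d := Rmin (d0 / 2) A).
  assert (HA : 0 < A) by (unfold A; pose proof (Rabs_pos K); lra).
  assert (Hd : 0 < d <= A /\ d < d0).
  { unfold d. pose proof (Rmin_l (d0 / 2) A). pose proof (Rmin_r (d0 / 2) A).
    assert (0 < Rmin (d0 / 2) A) by (apply Rmin_pos; lra). lra. }
  set (G := fun s => g (clamp 0 A s)).
  assert (HGc : continuity G) by apply (continuity_comp _ _ (continuity_clamp 0 A) Hgc).
  assert (HGnn : forall s, 0 <= G s) by (intros s; apply Hgnn, clamp_bounds; lra).
  destruct (continuity_bounded_above g A Hgc ltac:(lra)) as [B HB].
  destruct (shooting N G B lam d A) as (w & J & HS & Hw0 & Hw1); auto; try lra.
  { intros s. split; [apply HGnn|]. apply HB, clamp_bounds; lra. }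
  { intros w J HS Hw0. apply (radial_sol_small_initial_value N g lam lam1 mu A d w J); auto;
      [lra|unfold mu; lra|lra|].
    intros s Hs. destruct (Req_dec s 0) as [->|Hs0]; [rewrite Hg0, pow_i by lia; lra|].
    specialize (Hsub1 s ltac:(lra)).
    apply Rmult_le_compat_l with (r := lam ^ N) in Hsub1; [|apply pow_le; lra].
    rewrite <- Rmult_assoc, <- Rpow_mult_distr in Hsub1.
    now replace (lam * (mu / lam)) with mu in Hsub1 by (field; lra). }
  { intros w J HS Hw0. apply (radial_sol_large_initial_value N g lam A w J); auto; [lra|].
    intros s Hs. assert (Hs' : 0 < s /\ K < s) by (unfold A in Hs; pose proof (Rle_abs K); pose proof (Rabs_pos K); lra).
    specialize (HK s ltac:(lra) ltac:(lra)). assert (0 < s ^ N) by (apply pow_lt; lra).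
    apply Rmult_lt_compat_r with (r := s ^ N) in HK; [|assumption].
    replace (g s / s ^ N * s ^ N) with (g s) in HK by (field; lra). lra. }
  assert (HGpos : forall s, 0 < s <= A -> 0 < G s).
  { intros s Hs. unfold G. rewrite clamp_id by lra. apply Hgpos; lra. }
  assert (Hwpos := radial_sol_pos N G lam A w J HN ltac:(lra) HGnn HGpos HS ltac:(lra) Hw1).
  assert (HwA : forall r, 0 <= r <= 1 -> w r <= A).
  { intros r Hr. apply Rle_trans with (w 0); [|lra].
    apply (radial_sol_decreasing N G lam w J); auto; lra. }
  destruct (radial_sol_C2 N G lam w J) as (w1 & w2 & H1 & H2 & H3 & H4 & H5 & H6); auto; [lra| |].
  { intros r Hr. apply HGpos. specialize (Hwpos r Hr). specialize (HwA r ltac:(lra)). lra. }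
  exists w, w1, w2. repeat split; auto.
  - intros r Hr. specialize (H4 r Hr). unfold G in H4.
    rewrite clamp_id in H4; [exact H4|].
    specialize (Hwpos r ltac:(lra)). specialize (HwA r ltac:(lra)). lra.
  - intros r Hr. apply Hwpos; lra.
Qed.

Lemma deriv_on01_opp (F F' : R -> R) : deriv_on01 F F' -> deriv_on01 (fun r => - F r) (fun r => - F' r).
Proof.
  intros H r Hr eps He. destruct (H r Hr eps He) as [d [Hd H']]. exists d; split; [exact Hd|].
  intros h Hh Hlt Hrh. rewrite <- Rabs_Ropp.
  replace (- ((- F (r + h) - - F r) / h - - F' r)) with ((F (r + h) - F r) / h - F' r) by (field; exact Hh).
  now apply H'.
Qed.

Theorem theorem4p3 (N : nat) (f : R -> R) (f0 lam1 lam : R) :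
  (1 <= N)%nat ->
  cond_f1 N f ->
  0 < f0 -> f_zero_limit N f f0 ->
  f_infty_plus_infty N f ->
  is_first_eigenvalue N lam1 ->
  0 < lam < lam1 / f0 ->
  exists up um : R -> R,
    solves_MO N f lam up /\ (forall r, 0 < r < 1 -> 0 < up r) /\ strictly_concave_01 up /\
    solves_MO N f lam um /\ (forall r, 0 < r < 1 -> um r < 0) /\ strictly_convex_01 um.
Proof.
  intros HN [Hfc Hfs] Hf0 Hz Hi [Hlam1 [Heig _]] Hlam.
  assert (Hsq : (-1) ^ N * (-1) ^ N = 1).
  { rewrite <- Rpow_mult_distr. replace (-1 * -1) with 1 by ring. apply pow1. }
  assert (Hopp : forall x, (- x) ^ N = (-1) ^ N * x ^ N).
  { intros x. rewrite <- Rpow_mult_distr. f_equal. ring. }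
  assert (Hm1 : (-1) ^ N <> 0) by (intros E; rewrite E in Hsq; lra).
  assert (Hratio : forall s, 0 < s -> (-1) ^ N * f (- s) / s ^ N = f (- s) / (- s) ^ N).
  { intros s Hs. assert (0 < s ^ N) by (apply pow_lt; lra). rewrite Hopp.
    rewrite <- (Rmult_1_l (f (- s) / ((-1) ^ N * s ^ N))), <- Hsq. field; lra || auto. }
  (* The equation contains [f(-u)], so a positive [u] sees [f] at negative arguments. Since
     [(u')^N = (-1)^N (-u')^N], the factor [(-1)^N] moves to the right-hand side; it also makes the
     reflected function positive and leaves both limits unchanged. *)
  destruct (positive_radial_solution N (fun s => (-1) ^ N * f (- s)) f0 lam1 lam)
    as (u & u1 & u2 & U1 & U2 & U3 & U4 & U5 & U6 & U7 & U8); auto.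
  { apply (continuity_scal (fun s => f (- s))). apply (continuity_comp (fun s => - s) f); [|exact Hfc].
    apply (continuity_opp id), derivable_continuous, derivable_id. }
  { intros s Hs. assert (H := Hfs (- s) ltac:(lra)). rewrite Hopp in H.
    apply Rmult_lt_reg_r with (s ^ N); [apply pow_lt; lra|]. lra. }
  { intros eps He. destruct (Hz eps He) as [d [Hd H]]. exists d; split; [exact Hd|].
    intros s Hs. rewrite Hratio by lra. apply H; [lra|]. rewrite Rabs_Ropp, Rabs_right; lra. }
  { intros M. destruct (Hi M) as [K HK]. exists K. intros s Hs HKs. rewrite Hratio by lra.
    apply HK. rewrite Rabs_Ropp, Rabs_right; lra. }
  (* With [um = - v] the argument [- um] is [v] and [um' = - v'], so [f] itself is the nonlinearity
     and the equation carries over without a sign. *)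
  destruct (positive_radial_solution N f f0 lam1 lam)
    as (v & v1 & v2 & V1 & V2 & V3 & V4 & V5 & V6 & V7 & V8); auto.
  { intros s Hs. assert (H := Hfs s ltac:(lra)).
    apply Rmult_lt_reg_r with (s ^ N); [apply pow_lt; lra|]. lra. }
  { intros eps He. destruct (Hz eps He) as [d [Hd H]]. exists d; split; [exact Hd|].
    intros s Hs. apply H; [lra|]. rewrite Rabs_right; lra. }
  { intros M. destruct (Hi M) as [K HK]. exists K. intros s Hs HKs.
    apply HK. rewrite Rabs_right; lra. }
  exists u, (fun r => - v r). repeat split; auto.
  - exists u1, u2. repeat split; auto. intros r Hr.
    replace (lam ^ N * INR N * r ^ (N - 1) * f (- u r)) with
      ((-1) ^ N * (lam ^ N * INR N * r ^ (N - 1) * ((-1) ^ N * f (- u r)))).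
    + apply derivable_pt_lim_local01 with (fun s => (-1) ^ N * (- u1 s) ^ N); [exact Hr| |].
      * intros y _. rewrite Hopp, <- Rmult_assoc, Hsq. ring.
      * apply (derivable_pt_lim_scal (fun s => (- u1 s) ^ N)). now apply U4.
    + transitivity (((-1) ^ N * (-1) ^ N) * (lam ^ N * INR N * r ^ (N - 1) * f (- u r))); [ring|].
      rewrite Hsq. ring.
  - exists (fun r => - v1 r), (fun r => - v2 r).
    split; [now apply deriv_on01_opp|]. split; [now apply deriv_on01_opp|].
    split; [now apply cont_on01_opp|]. split; [|lra].
    intros r Hr. rewrite Ropp_involutive. now apply V4.
  - intros r Hr. specialize (V7 r Hr). lra.
  - intros x y t Hx Hy Hne Ht. specialize (V8 x y t Hx Hy Hne Ht). lra.
Qed.
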